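(* Let $Y_h$, $Y$, $X_n$, $\rho_h$ and the constants $\rho,\kappa,\zeta,r$ satisfy all the conditions listed in the context, and let $d=\zeta^{-1}$. There is a sequence of nonnegative integers $h_n$ such that $X_n$ is equal to $h_n$ or $h_n+1$ with high probability (i.e., with probability tending to $1$ as $n\to\infty$). Specifically, with $m_n=\log_r\log_d(n)$ and $\{m_n\}$ denoting its fractional part, one can set $$h_n=\begin{cases}\lfloor m_n\rfloor&\text{if }\{m_n\}\le\frac12,\\ \lceil m_n\rceil&\text{if }\{m_n\}>\frac12\end{cases}$$ (for all sufficiently large $n$). If we restrict to those values of $n$ for which $\{m_n\}\in[\varepsilon,1-\varepsilon]$, where $\varepsilon>0$ is fixed, then with high probability $X_n$ is equal to $\lceil m_n\rceil$.
   Context: Conditions. $Y_h(x)=\sum_{n\ge0}y_{h,n}x^n$ ($h\ge0$) is a sequence of generating functions with nonnegative coefficients such that $y_{h,n}$ is nondecreasing in $h$ and (coefficientwise) $\lim_{h\to\infty}Y_h(x)=Y(x)=\sum_{n\ge0}y_nx^n$. $X_n$ is the sequence of random variables with support $\mathbb{N}_0$ (nonnegative integers) defined by $\mathbb{P}(X_n\le h)=y_{h,n}/y_n$. Each $Y_h$ has a singularity at $\rho_h\in\mathbb{R}$ such that: (1) $\rho_h=\rho(1+\kappa\zeta^{r^h}+o(\zeta^{r^h}))$ as $h\to\infty$ for some constants $\rho>0$, $\kappa>0$, $\zeta\in(0,1)$ and $r>1$. (2) $Y_h(x)$ can be continued analytically to the domain $\{x\in\mathbb{C}: |x|\le(1+\delta)|\rho_h|,\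 |\operatorname{Arg}(x/\rho_h-1)|>\phi\}$ for some fixed $\delta>0$ and $\phi\in(0,\pi/2)$, and $Y_h(x)=U_h(x)+A_h(1-x/\rho_h)^\alpha+o((1-x/\rho_h)^\alpha)$ holds within this domain, uniformly in $h$, where $U_h(x)$ is analytic and uniformly bounded in $h$ within this region, $\alpha\in\mathbb{R}\setminus\mathbb{N}_0$, and $A_h$ is a constant dependent on $h$ such that $\lim_{h\to\infty}A_h=A\neq0$. Finally, $Y(x)=U(x)+A(1-x/\rho)^\alpha+o((1-x/\rho)^\alpha)$ in the region $\{x\in\mathbb{C}: |x|\le(1+\delta)|\rho|,\ |\operatorname{Arg}(x/\rho-1)|>\phi\}$ for a function $U(x)$ that is analytic within this region. Conventions: $\operatorname{Arg}$ is the principal argument; powers are principal branches. The $o$-terms in the expansions of $Y_h$ and $Y$ refer to $x\to\rho_h$ (respectively $x\to\rho$) within the stated domain, the estimate holding throughout the domain and, for $Y_h$, uniformly in $h$: there is a bounded function $\omega:(0,\infty)\to[0,\infty)$, independent of $h$, with $\omega(t)\to0$ as $t\to0^+$, such that the error term is at most $\omega(|1-x/\rho_h|)\,|1-x/\rho_h|^\alpha$ in absolute value for all $x$ in the domain (and analogously for $Y$).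
   Formalization: U_h is required to be analytic and uniformly bounded on the whole disc |x| ≤ (1+δ)|ρ_h|, not only on the region with the sector removed; with the latter the claim fails for α > 0, e.g. α = 1/2 and U_h = 10 − (1+c_h−x/ρ_h)^{1/4}, c_h = ζ^{r^{h−0.9}}. *)

(* Defs.v *)
From Stdlib Require Import Reals Zfloor.
From mathcomp Require Import all_boot.
From mathcomp Require Import classical_sets constructive_ereal reals Rstruct measure probability.
From Coquelicot Require Import Coquelicot.

Set Implicit Arguments.
Unset Strict Implicit.
Unset Printing Implicit Defensive.

Local Open Scope R_scope.

Definition analytic_at (f : C -> C) (z0 : C) : Prop :=
  exists (a : nat -> C) (r : posreal), forall z : C,
    Cmod (z - z0)%C < r ->
    @is_pseries C_AbsRing C_NormedModule a (z - z0)%C (f z).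

Definition analytic_on (D : C -> Prop) (f : C -> C) : Prop :=
  forall z : C, D z -> analytic_at f z.

(* [F] agrees near 0 with the generating function of [c], which converges
   there. *)
Definition continues (c : nat -> R) (F : C -> C) : Prop :=
  exists r : posreal, forall x : C, Cmod x < r ->
    @is_pseries C_AbsRing C_NormedModule (fun n => RtoC (c n)) x (F x).

(* [z0] is a singularity of [F], an analytic function on [D] with [z0] in the
   closure of [D]: no function analytic at [z0] agrees with [F] on [D] near
   [z0]. *)
Definition singular_at (D : C -> Prop) (F : C -> C) (z0 : C) : Prop :=
  ~ exists g : C -> C, analytic_at g z0 /\
      locally z0 (fun z => D z -> g z = F z).

(* Principal argument, in (-PI, PI]. The value at 0 is set to 0 by hand (the
   formula with [acos] would give PI / 2), so that the apex of the sector is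
   excluded from [slit_disc]. *)
Definition Arg (z : C) : R :=
  if Req_dec_T (Cmod z) 0 then 0
  else if Rle_dec 0 (Im z) then acos (Re z / Cmod z)
  else - acos (Re z / Cmod z).

(* Principal branch of z ^ a for a real exponent [a]; meaningful only for
   z <> 0. *)
Definition Cpower (z : C) (a : R) : C :=
  (RtoC (Rpower (Cmod z) a) * (cos (a * Arg z), sin (a * Arg z)))%C.

(* The regular part U_h of Y_h is to be analytic on the whole of [closed_disc], also
   across the sector at [rho] that is removed in [slit_disc], where Y_h lives.
   If U_h is only analytic and bounded on [slit_disc] and 0 < alpha, it can
   contain terms such as (1 + c_h - x / rho_h)^beta with 0 < beta < alpha and
   c_h -> 0; these dominate the coefficients, and the concentration result
   then fails. *)
Definition closed_disc (delta rho : R) (x : C) : Prop :=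
  Cmod x <= (1 + delta) * Rabs rho.

Definition slit_disc (delta phi rho : R) (x : C) : Prop :=
  closed_disc delta rho x /\ phi < Rabs (Arg (x / RtoC rho - 1)%C).

Definition error_modulus (omega : R -> R) : Prop :=
  (forall t, 0 < t -> 0 <= omega t) /\
  (exists M, forall t, 0 < t -> omega t <= M) /\
  filterlim omega (at_right 0) (locally 0).

(* F(x) = U(x) + A (1 - x/rho)^alpha + o((1 - x/rho)^alpha) on [D], the error
   being controlled by [omega]. *)
Definition expansion (D : C -> Prop) (F U : C -> C) (A : C) (alpha rho : R)
    (omega : R -> R) : Prop :=
  forall x : C, D x ->
    let z := (1 - x / RtoC rho)%C in
    Cmod (F x - (U x + A * Cpower z alpha))%C
      <= omega (Cmod z) * Rpower (Cmod z) alpha.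

(* Nearest integer, with ties rounded down. *)
Definition round_half_down (m : R) : Z :=
  if Rle_dec (frac_part m) (1 / 2) then Zfloor m else Zceil m.

(* Probability of an event, as a real number. *)
Definition Pr (disp : measure_display) (T : measurableType disp)
    (P : probability T R) (E : set T) : R := fine (P E).

(* Main.v *)
Require Import Defs.
From Stdlib Require Import Reals Zfloor ZArith Lra Lia.
From mathcomp Require Import all_boot.
From mathcomp Require boolp.
From mathcomp Require Import classical_sets constructive_ereal reals Rstruct measure probability.
From Coquelicot Require Import Coquelicot.

(** Singularity analysis shows that, uniformly in [h],
      [y h n = rhoh h ^ (- n) * b n * (Ah h + o(1))]   as [n -> oo],
    where [b n] is the coefficient of [w ^ n] in [(1 - w) ^ alpha]. Since this is
    uniform, [h -> oo] gives [yl n = rho ^ (- n) * b n * (A + o(1))], hence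
      [P(X n <= h) = y h n / yl n ~ (rho / rhoh h) ^ n ~ exp (- kappa n zeta^(r^h))]
    as [n] and [h] tend to infinity. With [d = / zeta], [n = d ^ (r ^ m n)] by
    definition of [m n], so that [n zeta^(r^h) = d ^ (r ^ m n - r ^ h)]: this tends to 0
    if [h >= m n + eta] and to infinity if [h <= m n - eta]. The distribution
    function therefore jumps from nearly 0 to nearly 1 between [m n - eta] and
    [m n + eta] ([cdf_low], [cdf_high]), which leaves two possible values for [X n]
    when [eta = 1/2], and one when [m n] stays away from the integers.

    The uniform estimate ([transfer]) rests on Cauchy's formula for the closed
    curves [w = exp (a + c sin (t/2) + i t)], [0 <= t <= 2 PI]. These are star-shaped
    about the origin, so they can be contracted to 0 by scaling inside the slit
    domain, which is star-shaped too; the integral is constant along the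
    contraction ([Cauchy_mean_value]). For [a = - 1/n] and small [c > 0] the curve
    passes between 0 and 1 at distance about [1/n] from 1 and, away from 1,
    lies outside the unit disc. On it [|w| ^ (- n)] is of order
    [exp (- c n sin (t/2))] and [|1 - w|] of order [1/n + sin (t/2)]; the error term
    thus contributes [o(n ^ (- alpha - 1))] ([arc_majorant]). The circle [c = 0],
    [a > 0] shows that the regular part contributes an exponentially small
    amount. Finally [|b n|] is at least a constant times [n ^ (- alpha - 1)]
    ([bin_coef_lower]), because [alpha] is not a nonnegative integer, so that the
    main term dominates.

    Differentiability is used in the two-point form [sdiff]. A power series has
    it at its centre, and it makes derivatives continuous, which is what
    differentiation under the integral sign requires. *)

Local Open Scope R_scope.

(** * Inequalities for the complex modulus *)

Lemma Cmod_sub_sym (x y : C) : Cmod (x - y) = Cmod (y - x).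
Proof. by rewrite -Cmod_opp; congr Cmod; ring. Qed.

Lemma Cmod_triangle3 (a b c : C) : Cmod (a - c) <= Cmod (a - b) + Cmod (b - c).
Proof.
have -> : (a - c = (a - b) + (b - c))%C by ring.
exact: Cmod_triangle.
Qed.

Lemma Cmod_lower (a b : C) : Cmod a - Cmod b <= Cmod (a - b).
Proof.
have := Cmod_triangle (a - b) b.
have -> : (a - b + b = a)%C by ring.
lra.
Qed.

Lemma Cmod_sub_le (a b : C) : Cmod (a - b) <= Cmod a + Cmod b.
Proof. by have := Cmod_triangle a (- b); rewrite Cmod_opp. Qed.

Lemma Im_le_Cmod (c : C) : Rabs (Im c) <= Cmod c.
Proof. exact: Rle_trans (Rmax_r _ _) (Rmax_Cmod c). Qed.

Lemma Cmod_le_Re_Im (c : C) : Cmod c <= Rabs (Re c) + Rabs (Im c).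
Proof.
apply: Rsqr_incr_0_var; last by have := Rabs_pos (Re c); have := Rabs_pos (Im c); lra.
rewrite !Rsqr_pow2 Cmod2_alt -(pow2_abs (Re c)) -(pow2_abs (Im c)).
have := Rabs_pos (Re c); have := Rabs_pos (Im c); nra.
Qed.

(** * Limits and strict derivatives of complex functions *)

(** Limits measured by the modulus, along an arbitrary filter: they are needed
    for functions of one real variable and for functions of two. *)
Definition clim {T : Type} (F : (T -> Prop) -> Prop) (g : T -> C) (l : C) :=
  forall eps, 0 < eps -> F (fun x => Cmod (g x - l) < eps).

Definition ccont (f : C -> C) (z : C) :=
  forall eps, 0 < eps -> exists2 d, 0 < d &
    forall u, Cmod (u - z) < d -> Cmod (f u - f z) < eps.

Definition copen (D : C -> Prop) :=
  forall z, D z -> exists2 d, 0 < d & forall u, Cmod (u - z) < d -> D u.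

Section Clim.
Context {T : Type} (F : (T -> Prop) -> Prop) {FF : Filter F}.

Lemma clim_const (l : C) : clim F (fun _ => l) l.
Proof.
move=> eps he; apply: filter_forall => x.
by rewrite (_ : (l - l = 0)%C) ?Cmod_0 //; ring.
Qed.

Lemma clim_mult f g (a b : C) :
  clim F f a -> clim F g b -> clim F (fun x => f x * g x)%C (a * b)%C.
Proof.
move=> ha hb eps he.
have a0 := Cmod_ge_0 a; have b0 := Cmod_ge_0 b.
set e := Rmin 1 (eps / (2 * (1 + Cmod a + Cmod b))).
have hq : 0 < eps / (2 * (1 + Cmod a + Cmod b)) by apply: Rdiv_lt_0_compat; lra.
have he2 : 0 < e by apply: Rmin_glb_lt; lra.
apply: filter_imp (filter_and _ _ (ha _ he2) (hb _ he2)) => x [h1 h2].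
have -> : (f x * g x - a * b = (f x - a) * (g x - b) + (f x - a) * b
  + a * (g x - b))%C by ring.
have t1 := Cmod_triangle ((f x - a) * (g x - b) + (f x - a) * b) (a * (g x - b)).
have t2 := Cmod_triangle ((f x - a) * (g x - b)) ((f x - a) * b).
move: t1 t2; rewrite !Cmod_mult.
have e1 : e <= 1 by apply: Rmin_l.
have e2 : e <= eps / (2 * (1 + Cmod a + Cmod b)) by apply: Rmin_r.
have e3 : e * (1 + Cmod a + Cmod b) <= eps / 2.
  have := Rmult_le_compat_r (1 + Cmod a + Cmod b) _ _ ltac:(lra) e2.
  have -> : eps / (2 * (1 + Cmod a + Cmod b)) * (1 + Cmod a + Cmod b) = eps / 2
    by field; lra.
  by [].
have p0 := Cmod_ge_0 (f x - a); have q0 := Cmod_ge_0 (g x - b).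
have : Cmod (f x - a) * Cmod (g x - b) <= e by nra.
have : Cmod (f x - a) * Cmod b <= e * Cmod b by nra.
have : Cmod a * Cmod (g x - b) <= e * Cmod a by nra.
lra.
Qed.

Lemma clim_comp (f : C -> C) g (l : C) :
  clim F g l -> ccont f l -> clim F (fun x => f (g x)) (f l).
Proof.
move=> hg hf eps he; case: (hf _ he) => d d0 hd.
by apply: filter_imp (hg _ d0) => x; apply: hd.
Qed.

Lemma clim_pair (f g : T -> R) (a b : R) :
  filterlim f F (locally a) -> filterlim g F (locally b) ->
  clim F (fun x => (f x, g x)) (a, b).
Proof.
move=> ha hb eps he.
have he2 : 0 < eps / 2 by lra.
have h1 : F (fun x => ball a (mkposreal _ he2) (f x)) := ha _ (locally_ball a _).
have h2 : F (fun x => ball b (mkposreal _ he2) (g x)) := hb _ (locally_ball b _).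
apply: filter_imp (filter_and _ _ h1 h2) => x [].
rewrite /ball /= /AbsRing_ball /abs /minus /plus /opp /= => k1 k2.
apply: Rle_lt_trans (Cmod_le_Re_Im _) _ => /=.
rewrite /Rminus in k1 k2 *; lra.
Qed.

Lemma clim_Re g (l : C) : clim F g l -> filterlim (fun x => Re (g x)) F (locally (Re l)).
Proof.
move=> hg P [eps hP]; change (F (fun x => P (Re (g x)))).
apply: filter_imp (hg _ (cond_pos eps)) => x hx.
apply: hP; rewrite /ball /= /AbsRing_ball /abs /minus /plus /opp /=.
have := re_le_Cmod (g x - l); rewrite /Re /= /Rminus; lra.
Qed.

End Clim.

(** The two-point form of differentiability: unlike the usual one-point
    form, it makes the derivative continuous as soon as it exists on an open
    set, and it passes to local inverses. *)
Definition sdiff (f : C -> C) (z a : C) :=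
  forall eps, 0 < eps -> exists2 d, 0 < d &
    forall u v, Cmod (u - z) < d -> Cmod (v - z) < d ->
      Cmod (f u - f v - a * (u - v)) <= eps * Cmod (u - v).

Definition holo (D : C -> Prop) (f f' : C -> C) :=
  forall z, D z -> sdiff f z (f' z).

Lemma Cmod_self (z : C) : Cmod (z - z) = 0.
Proof. by rewrite (_ : (z - z = 0)%C) ?Cmod_0 //; ring. Qed.

Lemma sdiff_lip f z a : sdiff f z a -> exists2 d, 0 < d &
  forall u v, Cmod (u - z) < d -> Cmod (v - z) < d ->
    Cmod (f u - f v) <= (Cmod a + 1) * Cmod (u - v).
Proof.
move=> h; case: (h 1 Rlt_0_1) => d d0 hd; exists d => // u v hu hv.
have := hd u v hu hv.
have := Cmod_lower (f u - f v) (a * (u - v)); rewrite Cmod_mult; lra.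
Qed.

Lemma sdiff_ccont f z a : sdiff f z a -> ccont f z.
Proof.
move=> /sdiff_lip [d d0 hd] eps he.
have a0 := Cmod_ge_0 a.
have hq : 0 < eps / (Cmod a + 1) by apply: Rdiv_lt_0_compat; lra.
exists (Rmin d (eps / (Cmod a + 1))); first exact: Rmin_glb_lt.
move=> u hu.
have hu1 := Rlt_le_trans _ _ _ hu (Rmin_l _ _).
have hu2 := Rlt_le_trans _ _ _ hu (Rmin_r _ _).
have := hd u z hu1; rewrite Cmod_self => /(_ d0) h.
apply: Rle_lt_trans h _.
have := Rmult_lt_compat_l (Cmod a + 1) _ _ ltac:(lra) hu2.
by have -> : (Cmod a + 1) * (eps / (Cmod a + 1)) = eps by field; lra.
Qed.

Lemma sdiff_const c z : sdiff (fun _ => c) z 0.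
Proof.
move=> eps he; exists 1 => [|u v _ _]; first lra.
rewrite (_ : (c - c - 0 * (u - v) = 0)%C) ?Cmod_0; last by ring.
by apply: Rmult_le_pos; [lra|exact: Cmod_ge_0].
Qed.

Lemma sdiff_id z : sdiff (fun w => w) z 1.
Proof.
move=> eps he; exists 1 => [|u v _ _]; first lra.
rewrite (_ : (u - v - 1 * (u - v) = 0)%C) ?Cmod_0; last by ring.
by apply: Rmult_le_pos; [lra|exact: Cmod_ge_0].
Qed.

Lemma sdiff_plus f g z a b : sdiff f z a -> sdiff g z b ->
  sdiff (fun w => f w + g w)%C z (a + b)%C.
Proof.
move=> hf hg eps he.
have he2 : 0 < eps / 2 by lra.
case: (hf _ he2) => d d0 hd; case: (hg _ he2) => d' d0' hd'.
exists (Rmin d d'); first exact: Rmin_glb_lt.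
move=> u v hu hv.
have hu1 := Rlt_le_trans _ _ _ hu (Rmin_l _ _).
have hu2 := Rlt_le_trans _ _ _ hu (Rmin_r _ _).
have hv1 := Rlt_le_trans _ _ _ hv (Rmin_l _ _).
have hv2 := Rlt_le_trans _ _ _ hv (Rmin_r _ _).
have -> : (f u + g u - (f v + g v) - (a + b) * (u - v) =
  (f u - f v - a * (u - v)) + (g u - g v - b * (u - v)))%C by ring.
apply: Rle_trans (Cmod_triangle _ _) _.
have := hd _ _ hu1 hv1; have := hd' _ _ hu2 hv2; lra.
Qed.

Lemma sdiff_mult f g z a b : sdiff f z a -> sdiff g z b ->
  sdiff (fun w => f w * g w)%C z (a * g z + f z * b)%C.
Proof.
move=> hf hg eps he.
have cf := sdiff_ccont _ _ _ hf; have cg := sdiff_ccont _ _ _ hg.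
case: (sdiff_lip _ _ _ hf) => d1 d10 lf.
set K := Cmod a + 1 + Cmod b + Cmod (f z) + Cmod (g z) + 1.
have a0 := Cmod_ge_0 a; have b0 := Cmod_ge_0 b.
have f0 := Cmod_ge_0 (f z); have g0 := Cmod_ge_0 (g z).
have K1 : 1 <= K by rewrite /K; lra.
set e := Rmin 1 (eps / (4 * K)).
have hq : 0 < eps / (4 * K) by apply: Rdiv_lt_0_compat; lra.
have he2 : 0 < e by apply: Rmin_glb_lt; lra.
have e1 : e <= 1 by apply: Rmin_l.
have eK : e * K <= eps / 4.
  have h : e <= eps / (4 * K) by apply: Rmin_r.
  have := Rmult_le_compat_r K _ _ ltac:(lra) h.
  by have -> : eps / (4 * K) * K = eps / 4 by field; lra.
case: (hf _ he2) => d2 d20 hd2; case: (hg _ he2) => d3 d30 hd3.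
case: (cf _ he2) => d4 d40 hd4; case: (cg _ he2) => d5 d50 hd5.
set d := Rmin d1 (Rmin d2 (Rmin d3 (Rmin d4 d5))).
have dd1 : d <= d1 by exact: Rmin_l.
have dd2 : d <= d2 by apply: Rle_trans (Rmin_r _ _) (Rmin_l _ _).
have dd3 : d <= d3.
  by apply: Rle_trans (Rmin_r _ _) (Rle_trans _ _ _ (Rmin_r _ _) (Rmin_l _ _)).
have dd4 : d <= d4.
  by do 3! apply: Rle_trans (Rmin_r _ _) _; exact: Rmin_l.
have dd5 : d <= d5.
  by do 3! apply: Rle_trans (Rmin_r _ _) _; exact: Rmin_r.
exists d; first by do! apply: Rmin_glb_lt.
move=> u v hu hv.
have L := lf u v ltac:(lra) ltac:(lra).
have A1 := hd2 u v ltac:(lra) ltac:(lra).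
have A2 := hd3 u v ltac:(lra) ltac:(lra).
have A4 := hd4 v ltac:(lra).
have A5 := hd5 u ltac:(lra).
have -> : (f u * g u - f v * g v - (a * g z + f z * b) * (u - v) =
  (f u - f v - a * (u - v)) * g z + (f u - f v) * (g u - g z)
  + f z * (g u - g v - b * (u - v)) + (f v - f z) * (g u - g v - b * (u - v))
  + (f v - f z) * b * (u - v))%C by ring.
have t1 := Cmod_triangle ((f u - f v - a * (u - v)) * g z + (f u - f v) * (g u - g z)
  + f z * (g u - g v - b * (u - v)) + (f v - f z) * (g u - g v - b * (u - v)))
  ((f v - f z) * b * (u - v)).
have t2 := Cmod_triangle ((f u - f v - a * (u - v)) * g z + (f u - f v) * (g u - g z)
  + f z * (g u - g v - b * (u - v))) ((f v - f z) * (g u - g v - b * (u - v))).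
have t3 := Cmod_triangle ((f u - f v - a * (u - v)) * g z + (f u - f v) * (g u - g z))
  (f z * (g u - g v - b * (u - v))).
have t4 := Cmod_triangle ((f u - f v - a * (u - v)) * g z) ((f u - f v) * (g u - g z)).
move: t1 t2 t3 t4; rewrite !Cmod_mult.
move: (Cmod_ge_0 (f u - f v)) (Cmod_ge_0 (f u - f v - a * (u - v)))
  (Cmod_ge_0 (g u - g v - b * (u - v))) (Cmod_ge_0 (f v - f z))
  (Cmod_ge_0 (g u - g z)) (Cmod_ge_0 (u - v)) L A1 A2 A4 A5.
move: (Cmod (f u - f v)) (Cmod (f u - f v - a * (u - v)))
  (Cmod (g u - g v - b * (u - v))) (Cmod (f v - f z))
  (Cmod (g u - g z)) (Cmod (u - v)) => x1 x2 x3 x4 x5 x p1 p2 p3 p4 p5 p L A1 A2 A4 A5.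
have B1 : x2 * Cmod (g z) <= (e * x) * Cmod (g z) by apply: Rmult_le_compat_r.
have B2 : x1 * x5 <= ((Cmod a + 1) * x) * e by apply: Rmult_le_compat; lra.
have B3 : Cmod (f z) * x3 <= Cmod (f z) * (e * x) by apply: Rmult_le_compat_l.
have B4 : x4 * x3 <= 1 * (e * x) by apply: Rmult_le_compat; lra.
have B5 : x4 * Cmod b * x <= e * Cmod b * x.
  by apply: Rmult_le_compat_r => //; apply: Rmult_le_compat_r => //; lra.
move=> t1 t2 t3 t4.
have : e * K * x <= eps / 4 * x by apply: Rmult_le_compat_r.
have : eps * x >= 0 by apply: Rle_ge; apply: Rmult_le_pos; lra.
rewrite /K; lra.
Qed.

Lemma sdiff_comp f g z a b : sdiff g z b -> sdiff f (g z) a ->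
  sdiff (fun w => f (g w)) z (a * b)%C.
Proof.
move=> hg hf eps he.
have cg := sdiff_ccont _ _ _ hg.
case: (sdiff_lip _ _ _ hg) => d1 d10 lg.
have a0 := Cmod_ge_0 a; have b0 := Cmod_ge_0 b.
have he1 : 0 < eps / (2 * (Cmod b + 1)) by apply: Rdiv_lt_0_compat; lra.
have he2 : 0 < eps / (2 * (Cmod a + 1)) by apply: Rdiv_lt_0_compat; lra.
case: (hf _ he1) => d2 d20 hd2; case: (hg _ he2) => d3 d30 hd3.
case: (cg _ d20) => d4 d40 hd4.
exists (Rmin d1 (Rmin d3 d4)); first by do! apply: Rmin_glb_lt.
move=> u v hu hv.
have r1 := Rmin_l d1 (Rmin d3 d4).
have r3 := Rle_trans _ _ _ (Rmin_r d1 (Rmin d3 d4)) (Rmin_l d3 d4).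
have r4 := Rle_trans _ _ _ (Rmin_r d1 (Rmin d3 d4)) (Rmin_r d3 d4).
have L := lg u v ltac:(lra) ltac:(lra).
have A2 := hd2 (g u) (g v) (hd4 u ltac:(lra)) (hd4 v ltac:(lra)).
have A3 := hd3 u v ltac:(lra) ltac:(lra).
have -> : (f (g u) - f (g v) - a * b * (u - v) =
  (f (g u) - f (g v) - a * (g u - g v)) + a * (g u - g v - b * (u - v)))%C by ring.
apply: Rle_trans (Cmod_triangle _ _) _; rewrite Cmod_mult.
have x0 := Cmod_ge_0 (u - v).
have B1 : eps / (2 * (Cmod b + 1)) * Cmod (g u - g v) <= eps / 2 * Cmod (u - v).
  apply: Rle_trans (Rmult_le_compat_l _ _ _ (Rlt_le _ _ he1) L) _.
  by apply: Req_le; field; lra.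
have B2 : Cmod a * Cmod (g u - g v - b * (u - v)) <= eps / 2 * Cmod (u - v).
  apply: Rle_trans (Rmult_le_compat_l _ _ _ a0 A3) _.
  have -> : Cmod a * (eps / (2 * (Cmod a + 1)) * Cmod (u - v)) =
    (Cmod a / (Cmod a + 1)) * (eps / 2 * Cmod (u - v)) by field; lra.
  rewrite -[X in _ <= X]Rmult_1_l; apply: Rmult_le_compat_r.
    by apply: Rmult_le_pos; lra.
  by apply/Rcomplements.Rle_div_l; lra.
lra.
Qed.

Lemma sdiff_inv (z : C) : z <> 0 -> sdiff Cinv z (- (/ (z * z)))%C.
Proof.
move=> z0 eps he.
have mz : 0 < Cmod z by apply/Cmod_gt_0.
set m := Cmod z in mz *.
set d := Rmin (m / 2) (eps * m ^ 3 / 10).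
have hq : 0 < eps * m ^ 3 / 10.
  by apply: Rdiv_lt_0_compat; [apply: Rmult_lt_0_compat => //; apply: pow_lt|lra].
exists d; first by apply: Rmin_glb_lt; lra.
move=> u v hu hv.
have r1 : d <= m / 2 by exact: Rmin_l.
have r2 : d <= eps * m ^ 3 / 10 by exact: Rmin_r.
have mu : m / 2 <= Cmod u.
  by have := Cmod_lower z u; rewrite Cmod_sub_sym -/m; lra.
have mv : m / 2 <= Cmod v.
  by have := Cmod_lower z v; rewrite Cmod_sub_sym -/m; lra.
have u0 : u <> 0 by apply/Cmod_gt_0; lra.
have v0 : v <> 0 by apply/Cmod_gt_0; lra.
have -> : (/ u - / v - - / (z * z) * (u - v) =
  (u - v) * (((u - z) * v + z * (v - z)) / (u * v * z * z)))%C by field.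
rewrite Cmod_mult Rmult_comm; apply: Rmult_le_compat_r; first exact: Cmod_ge_0.
rewrite Cmod_div; last by do 3! apply: Cmult_neq_0 => //.
rewrite !Cmod_mult -/m.
apply/Rcomplements.Rle_div_l.
  by do 3! (apply: Rmult_lt_0_compat; last lra); lra.
apply: Rle_trans (Cmod_triangle _ _) _; rewrite !Cmod_mult -/m.
have vm : Cmod v <= 3 / 2 * m.
  by have := Cmod_lower v z; rewrite -/m; lra.
have B1 : Cmod (u - z) * Cmod v <= d * (3 / 2 * m).
  by apply: Rmult_le_compat; try exact: Cmod_ge_0; lra.
have B2 : m * Cmod (v - z) <= m * d by apply: Rmult_le_compat_l; lra.
have B3 : eps * ((m / 2) * (m / 2) * m * m) <= eps * (Cmod u * Cmod v * m * m).
  apply: Rmult_le_compat_l; first lra.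
  do 2! (apply: Rmult_le_compat_r; first lra).
  by apply: Rmult_le_compat; lra.
have B4 : m * d <= m * (eps * m ^ 3 / 10) by apply: Rmult_le_compat_l; lra.
have e4 : eps * ((m / 2) * (m / 2) * m * m) = m * (eps * m ^ 3 / 10) * (5 / 2) by field.
lra.
Qed.

Lemma sdiff_eq f z a b : a = b -> sdiff f z a -> sdiff f z b.
Proof. by move=> ->. Qed.

Lemma sdiff_ext f g z a : (forall w, f w = g w) -> sdiff f z a -> sdiff g z a.
Proof.
move=> h hf eps he; case: (hf _ he) => d d0 hd; exists d => // u v.
by rewrite -!h; apply: hd.
Qed.

Lemma sdiff_ext_loc f g z a d : 0 < d ->
  (forall w, Cmod (w - z) < d -> f w = g w) -> sdiff f z a -> sdiff g z a.
Proof.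
move=> d0 h hf eps he; case: (hf _ he) => d' d0' hd.
exists (Rmin d d'); first exact: Rmin_glb_lt.
move=> u v hu hv.
have hu1 := Rlt_le_trans _ _ _ hu (Rmin_l _ _).
have hu2 := Rlt_le_trans _ _ _ hu (Rmin_r _ _).
have hv1 := Rlt_le_trans _ _ _ hv (Rmin_l _ _).
have hv2 := Rlt_le_trans _ _ _ hv (Rmin_r _ _).
by rewrite -!h //; apply: hd.
Qed.

Lemma sdiff_scal c z : sdiff (fun w => c * w)%C z c.
Proof.
apply: (sdiff_eq _ _ (0 * z + c * 1)%C); first by ring.
by apply: (sdiff_mult (fun _ => c) (fun w => w)); [exact: sdiff_const|exact: sdiff_id].
Qed.

(** For [w] near [z], the pairs [(w + t, w)] with small [t] can be used both in the
    estimate at [z] and in the estimate at [w], which compares [f' w] with [f' z]. *)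
Lemma holo_deriv_ccont D f f' : copen D -> holo D f f' ->
  forall z, D z -> ccont f' z.
Proof.
move=> oD hf z Dz eps he.
have he4 : 0 < eps / 4 by lra.
case: (hf z Dz _ he4) => d d0 hd; case: (oD _ Dz) => d' d0' hd'.
exists (Rmin d d'); first exact: Rmin_glb_lt.
move=> w hw.
have hw1 := Rlt_le_trans _ _ _ hw (Rmin_l _ _).
have hw2 := Rlt_le_trans _ _ _ hw (Rmin_r _ _).
case: (hf w (hd' _ hw2) _ he4) => e e0 hee.
set t := Rmin (e / 2) ((d - Cmod (w - z)) / 2).
have t0 : 0 < t by apply: Rmin_glb_lt; lra.
have te : t <= e / 2 by exact: Rmin_l.
have td : t <= (d - Cmod (w - z)) / 2 by exact: Rmin_r.
have mt : Cmod (RtoC t) = t by rewrite Cmod_R Rabs_pos_eq; lra.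
have E1 : (w + t - w = t)%C by ring.
have K1 := hee (w + t)%C w; rewrite E1 Cmod_self mt in K1.
have K2 := hd (w + t)%C w; rewrite E1 mt in K2.
have T := Cmod_triangle (w - z) t; rewrite mt in T.
have {}K1 := K1 ltac:(lra) e0.
have E2 : (w + t - z = w - z + t)%C by ring.
rewrite E2 in K2.
have {}K2 := K2 ltac:(lra) hw1.
have : Cmod ((f' w - f' z) * t) <= eps / 2 * t.
  have -> : ((f' w - f' z) * t = (f (w + t) - f w - f' z * t) -
    (f (w + t) - f w - f' w * t))%C by ring.
  apply: Rle_trans (Cmod_sub_le _ _) _; lra.
rewrite Cmod_mult mt => /(Rmult_le_reg_r _ _ _ t0); lra.
Qed.

(** * Power series are strictly differentiable at their centre *)

Lemma pow_nC (x : C) n : @pow_n C_Ring x n = (x ^ n)%C.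
Proof. by elim: n => [|n IH] //=; rewrite IH. Qed.

Lemma Cmod_powD (u v : C) m k : Cmod u <= m -> Cmod v <= m ->
  Cmod (u ^ k.+1 - v ^ k.+1)%C <= INR k.+1 * m ^ k * Cmod (u - v).
Proof.
move=> hu hv; have m0 := Rle_trans _ _ _ (Cmod_ge_0 u) hu.
have x0 := Cmod_ge_0 (u - v).
elim: k => [|k IH].
  rewrite /= !Cmult_1_r; lra.
have -> : (u ^ k.+2 - v ^ k.+2 = u * (u ^ k.+1 - v ^ k.+1) + (u - v) * v ^ k.+1)%C.
  by rewrite /=; ring.
apply: Rle_trans (Cmod_triangle _ _) _; rewrite !Cmod_mult Cmod_pow.
have B1 : Cmod u * Cmod (u ^ k.+1 - v ^ k.+1)%C <=
    m * (INR k.+1 * m ^ k * Cmod (u - v)).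
  by apply: Rmult_le_compat => //; exact: Cmod_ge_0.
have B2 : Cmod (u - v) * Cmod v ^ k.+1 <= Cmod (u - v) * m ^ k.+1.
  apply: Rmult_le_compat_l => //; apply: pow_incr; split => //; exact: Cmod_ge_0.
rewrite [INR k.+2]S_INR.
have -> : (INR k.+1 + 1) * m ^ k.+1 * Cmod (u - v) =
  m * (INR k.+1 * m ^ k * Cmod (u - v)) + Cmod (u - v) * m ^ k.+1 by rewrite -(tech_pow_Rmult m k); ring.
exact: Rplus_le_compat B1 B2.
Qed.

Lemma is_series_Cmod_le (s : nat -> C) (l b : C) B :
  is_series (V := C_NormedModule) s l ->
  (forall N, (1 <= N)%N -> Cmod (sum_n (G := C_AbelianMonoid) s N - b) <= B) -> Cmod (l - b) <= B.
Proof.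
move=> hs hB; apply: le_epsilon => eps he.
have /filterlim_locally_ball_norm := hs => /(_ (mkposreal _ he)) [N hN].
have h : Cmod (sum_n (G := C_AbelianMonoid) s N.+1 - l) < eps := hN N.+1 ltac:(lia).
have h2 := hB N.+1 (ltn0Sn N).
move: (sum_n s N.+1) h h2 => S h h2.
have := Cmod_triangle3 l S b; rewrite (Cmod_sub_sym l S) => h3.
lra.
Qed.

Lemma is_pseries_terms_bounded (a : nat -> C) (x l : C) :
  @is_pseries C_AbsRing C_NormedModule a x l ->
  exists2 B, 0 <= B & forall k, Cmod (x ^ k * a k)%C <= B.
Proof.
move=> h.
have [M hM] := filterlim_bounded _ (ex_intro _ _ h).
have {}hM : forall n, Cmod (sum_n (G := C_AbelianMonoid) (fun k => x ^ k * a k)%C n) <= M.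
  move=> n; rewrite (sum_n_ext _ (fun k => scal (@pow_n C_Ring x k) (a k : C_NormedModule)));
    [exact: hM|by move=> k; rewrite pow_nC].
have M0 : 0 <= M by apply: Rle_trans (Cmod_ge_0 _) (hM 0%N).
exists (2 * M); first lra.
case=> [|k].
  have := hM 0%N; rewrite sum_O; lra.
have := hM k.+1; have := hM k; rewrite sum_Sn.
move: (sum_n _ k) => S h1 h2.
have := Cmod_sub_le (plus S (x ^ k.+1 * a k.+1)%C) S.
have -> : (plus S (x ^ k.+1 * a k.+1) - S = x ^ k.+1 * a k.+1)%C.
  by rewrite /plus /=; ring.
lra.
Qed.

Lemma half_pow_bound k : INR k.+2 * (/ 4) ^ k <= 4 * (/ 2) ^ k.+1.
Proof.
elim: k => [|k IH]; first by rewrite /=; lra.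
have h : INR k.+3 <= 2 * INR k.+2 by rewrite (S_INR k.+2) S_INR; have := pos_INR k.+1; lra.
have p : 0 <= (/ 4) ^ k by apply: pow_le; lra.
rewrite -(tech_pow_Rmult (/4) k) -(tech_pow_Rmult (/2) k.+1); nra.
Qed.

(** Termwise, [u ^ k - v ^ k] is at most [k m^(k-1) |u - v|] on the disc of
    radius [m], so the terms of degree at least 2 contribute [O(m) |u - v|]. *)
Lemma analytic_at_sdiff f z : analytic_at f z -> exists a, sdiff f z a.
Proof.
case=> a [r hr]; exists (a 1%N) => eps he.
have r0 := cond_pos r.
set R := r / 2; have R0 : 0 < R by rewrite /R; lra.
have [B B0 hB] : exists2 B, 0 <= B & forall k, R ^ k * Cmod (a k) <= B.
  have h1 : (z + RtoC R - z = RtoC R)%C by ring.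
  have := hr (z + RtoC R)%C; rewrite h1 Cmod_R Rabs_pos_eq; last lra.
  move=> /(_ ltac:(rewrite /R; lra)) /is_pseries_terms_bounded [B B0 hB].
  exists B => // k; have := hB k.
  by rewrite Cmod_mult Cmod_pow Cmod_R Rabs_pos_eq //; lra.
set d := Rmin (R / 4) (eps * R * R / (4 * B + 1)).
have d0 : 0 < d.
  apply: Rmin_glb_lt; first lra.
  by apply: Rdiv_lt_0_compat; [do 2! apply: Rmult_lt_0_compat => //|lra].
have d1 : d <= R / 4 by exact: Rmin_l.
have d2 : d <= eps * R * R / (4 * B + 1) by exact: Rmin_r.
exists d => // u v hu hv.
have hdr : d < r by rewrite /R in d1; lra.
have su := hr u ltac:(lra); have sv := hr v ltac:(lra).
have {su sv} := is_series_minus _ _ _ _ su sv.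
move=> /is_series_Cmod_le -/(_ (a 1%N * (u - v))%C
  (4 * (B / R) * (d / R) * Cmod (u - v))) h.
have x0 := Cmod_ge_0 (u - v).
apply: Rle_trans (h _) _; last first.
  apply: Rmult_le_compat_r => //.
  have -> : 4 * (B / R) * (d / R) = (4 * B * d) / (R * R) by field; lra.
  apply/Rcomplements.Rle_div_l; first exact: Rmult_lt_0_compat.
  have : (4 * B + 1) * d <= eps * R * R.
    have := Rmult_le_compat_l (4 * B + 1) _ _ ltac:(lra) d2.
    by have -> : (4 * B + 1) * (eps * R * R / (4 * B + 1)) = eps * R * R by field; lra.
  nra.
move=> {h} [|N] // _.
have q0 : 0 <= d / R by apply: Rlt_le; apply: Rdiv_lt_0_compat.
have q4 : d / R <= / 4 by apply/Rcomplements.Rle_div_l; lra.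
have BR0 : 0 <= B / R by apply: Rdiv_le_0_compat.
suff : Cmod (sum_n (G := C_AbelianMonoid) (fun n => minus (scal (pow_n (u - v + (v - z))%C n) (a n))
    (scal (pow_n (v - z)%C n) (a n))) N.+1 - a 1%N * (u - v))%C
  <= 4 * (B / R) * (d / R) * Cmod (u - v) * (1 - (/ 2) ^ N).
  have -> : (u - v + (v - z) = u - z)%C by ring.
  move/Rle_trans; apply; rewrite -[X in _ <= X]Rmult_1_r.
  apply: Rmult_le_compat_l.
    by apply: Rmult_le_pos => //; apply: Rmult_le_pos => //; lra.
  have : 0 <= (/ 2) ^ N by apply: pow_le; lra.
  lra.
have -> : (u - v + (v - z) = u - z)%C by ring.
elim: N => [|N IH].
  rewrite sum_Sn sum_O /plus /minus /scal /opp /= /mult /= /plus /opp /= /one /=.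
  set X := (X in Cmod X).
  have -> : X = 0.
    by rewrite /X; ring.
  by rewrite Cmod_0; lra.
rewrite sum_Sn.
set S := sum_n _ _ in IH *.
have -> : (plus S (minus (scal (pow_n (u - z) N.+2) (a N.+2))
    (scal (pow_n (v - z) N.+2) (a N.+2))) - a 1%N * (u - v) =
  (S - a 1%N * (u - v)) + ((u - z) ^ N.+2 - (v - z) ^ N.+2) * a N.+2)%C.
  by rewrite -!pow_nC /plus /minus /scal /opp /= /mult /= /plus /opp /=; ring.
apply: Rle_trans (Cmod_triangle _ _) _; rewrite Cmod_mult.
have P := Cmod_powD (u - z) (v - z) d N.+1 (Rlt_le _ _ hu) (Rlt_le _ _ hv).
rewrite (_ : (u - z - (v - z) = u - v)%C) in P; last by ring.
have a0 := Cmod_ge_0 (a N.+2).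
have T : Cmod ((u - z) ^ N.+2 - (v - z) ^ N.+2)%C * Cmod (a N.+2) <=
   4 * (B / R) * (d / R) * Cmod (u - v) * (/ 2) ^ N.+1.
  apply: Rle_trans (Rmult_le_compat_r _ _ _ a0 P) _.
  have -> : INR N.+2 * d ^ N.+1 * Cmod (u - v) * Cmod (a N.+2) =
     INR N.+2 * (d / R) ^ N * (d / R) * (R ^ N.+2 * Cmod (a N.+2)) / R * Cmod (u - v).
    rewrite /Rdiv Rpow_mult_distr pow_inv -!tech_pow_Rmult; field.
    by have := pow_lt R N R0; split; lra.
  have -> : 4 * (B / R) * (d / R) * Cmod (u - v) * (/ 2) ^ N.+1 =
    4 * (/ 2) ^ N.+1 * (d / R) * B / R * Cmod (u - v) by field; lra.
  apply: Rmult_le_compat_r => //; apply: Rmult_le_compat_r.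
    by apply: Rlt_le; apply: Rinv_0_lt_compat.
  apply: Rmult_le_compat; last exact: hB.
  - repeat apply: Rmult_le_pos => //; [exact: pos_INR|exact: pow_le].
  - by apply: Rmult_le_pos => //; apply: pow_le; lra.
  apply: Rmult_le_compat_r => //.
  apply: Rle_trans (half_pow_bound N).
  by apply: Rmult_le_compat_l; [exact: pos_INR|apply: pow_incr].
have : (/ 2) ^ N = 2 * (/ 2) ^ N.+1 by rewrite -tech_pow_Rmult; field.
move=> e; rewrite e in IH; nra.
Qed.

(** * The complex exponential *)

Definition Cexp (u : C) : C := (exp (Re u) * cos (Im u), exp (Re u) * sin (Im u)).

Lemma CexpD a b : Cexp (a + b)%C = (Cexp a * Cexp b)%C.
Proof.
by rewrite /Cexp /Cmult /Re /Im /= exp_plus cos_plus sin_plus; congr pair; ring.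
Qed.

Lemma Cexp0 : Cexp 0 = 1.
Proof. by rewrite /Cexp /= exp_0 cos_0 sin_0 Rmult_1_r Rmult_0_r. Qed.

Lemma Cmod_Cexp u : Cmod (Cexp u) = exp (Re u).
Proof.
rewrite -(sqrt_Rsqr (exp (Re u))); last exact: Rlt_le (exp_pos _).
congr sqrt; rewrite /= !Rsqr_pow2.
have := sin2_cos2 (Im u); rewrite !Rsqr_pow2 => e.
have -> : (exp (Re u) * cos (Im u)) ^ 2 + (exp (Re u) * sin (Im u)) ^ 2 =
  exp (Re u) ^ 2 * (sin (Im u) ^ 2 + cos (Im u) ^ 2) by ring.
by rewrite e Rmult_1_r.
Qed.

Lemma Cexp_neq0 (u : C) : Cexp u <> 0.
Proof. by apply/Cmod_gt_0; rewrite Cmod_Cexp; exact: exp_pos. Qed.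

Lemma exp_le_inv x : x < 1 -> exp x <= / (1 - x).
Proof.
move=> hx; have := exp_ineq1_le (- x); rewrite exp_Ropp => h.
rewrite -(Rinv_inv (exp x)); apply: Rinv_le_contravar; lra.
Qed.

Lemma exp_sub1_bound x : Rabs x <= / 2 -> Rabs (exp x - 1 - x) <= 2 * x ^ 2.
Proof.
move=> /Rabs_le_between hx.
have h1 := exp_ineq1_le x; have h2 := exp_le_inv x ltac:(lra).
have h3 : / (1 - x) <= 1 + x + 2 * x ^ 2.
  apply: (Rmult_le_reg_l (1 - x)); first lra.
  rewrite Rinv_r; last lra; nra.
by rewrite Rabs_pos_eq; lra.
Qed.

Lemma Rabs_sin_le x : Rabs (sin x) <= Rabs x.
Proof.
have pos y : 0 < y -> Rabs (sin y) <= y.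
  move=> hy; have := sin_lt_x y hy; have b := SIN_bound y => h.
  case: (Rle_dec y 2) => h2; last by apply: Rabs_le; lra.
  have := PI2_3_2 => hp.
  by have := sin_ge_0 y ltac:(lra) ltac:(lra) => h0; rewrite Rabs_pos_eq; lra.
case: (Rtotal_order x 0) => [h|[->|h]].
- have := pos (- x) ltac:(lra); rewrite sin_neg Rabs_Ropp (Rabs_left x); lra.
- by rewrite sin_0; apply: Rle_refl.
- by rewrite (Rabs_pos_eq x); [exact: pos|lra].
Qed.

Lemma one_sub_cos_bound y : 0 <= 1 - cos y <= y ^ 2 / 2.
Proof.
split; first by have := COS_bound y; lra.
have {1}-> : y = 2 * (y / 2) by field.
rewrite cos_2a_sin.
have /Rsqr_le_abs_1 : Rabs (sin (y / 2)) <= Rabs (y / 2) by exact: Rabs_sin_le.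
rewrite /Rsqr; lra.
Qed.

Lemma sin_sub_id_bound y : Rabs y <= 1 -> Rabs (sin y - y) <= y ^ 2.
Proof.
move=> hy.
have [c [hc e]] := MVT_gen (fun t => sin t - t) 0 y (fun t => cos t - 1)
  ltac:(move=> t _; auto_derive => //; ring)
  ltac:(move=> t _; apply: derivable_continuous_pt;
    apply: derivable_pt_minus; [exact: derivable_pt_sin|exact: derivable_pt_id]).
move: e; rewrite sin_0 !Rminus_0_r => ->.
have [B1 B2] := one_sub_cos_bound c.
have c2 : Rabs c <= Rabs y.
  move: hc; rewrite /Rmin /Rmax; case: Rle_dec => h hc;
  rewrite /Rabs; do 2! case: Rcase_abs; lra.
have y0 := Rabs_pos y; have c0 := Rabs_pos c.
rewrite Rabs_mult -(pow2_abs y) Rabs_minus_sym Rabs_pos_eq //.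
move: B2; rewrite -(pow2_abs c); nra.
Qed.

Lemma Cexp_sub1_sub_bound h : Cmod h <= / 2 -> Cmod (Cexp h - 1 - h) <= 6 * Cmod h ^ 2.
Proof.
move=> hh.
have hx := Rle_trans _ _ _ (re_le_Cmod h) hh.
have hy := Rle_trans _ _ _ (Im_le_Cmod h) hh.
apply: Rle_trans (Cmod_le_Re_Im _) _.
rewrite Cmod2_alt /Cexp /Re /Im /=.
move: hx hy; rewrite /Re /Im; move: (fst h) (snd h) => x y hx hy.
have A1 := exp_sub1_bound x hx; have A2 := one_sub_cos_bound y.
have A3 := sin_sub_id_bound y ltac:(lra).
have e2 : 0 < exp x <= 2.
  split; first exact: exp_pos.
  move/Rabs_le_between: hx => hx.
  apply: Rle_trans (exp_le_inv x ltac:(lra)) _.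
  rewrite -(Rinv_inv 2); apply: Rinv_le_contravar; lra.
have e1 : Rabs (exp x - 1) <= 2 * Rabs x.
  have -> : exp x - 1 = (exp x - 1 - x) + x by ring.
  apply: Rle_trans (Rabs_triang _ _) _.
  have := Rabs_pos x; move: A1; rewrite -(pow2_abs x); nra.
have -> : exp x * cos y + - (1) + - x = (exp x - 1 - x) - exp x * (1 - cos y) by ring.
have -> : exp x * sin y + - 0 + - y = exp x * (sin y - y) + (exp x - 1) * y by ring.
have T1 := Rabs_triang (exp x - 1 - x) (- (exp x * (1 - cos y))).
have T2 := Rabs_triang (exp x * (sin y - y)) ((exp x - 1) * y).
move: T1 T2; rewrite Rabs_Ropp !Rabs_mult (Rabs_pos_eq (exp x)); last lra.
rewrite (Rabs_pos_eq (1 - cos y)); last lra.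
have y0 := Rabs_pos y; have x0 := Rabs_pos x.
have B1 : exp x * (1 - cos y) <= 2 * (y ^ 2 / 2) by apply: Rmult_le_compat; lra.
have B2 : exp x * Rabs (sin y - y) <= 2 * y ^ 2.
  by apply: Rmult_le_compat => //; [lra|exact: Rabs_pos|lra].
have B3 : Rabs (exp x - 1) * Rabs y <= (2 * Rabs x) * Rabs y by apply: Rmult_le_compat_r.
move: A1 B1 B2 B3; rewrite -(pow2_abs x) -(pow2_abs y) /Rminus => A1 B1 B2 B3 T1 T2.
have -> : x * (x * 1) = Rabs x ^ 2 by rewrite pow2_abs.
have -> : y * (y * 1) = Rabs y ^ 2 by rewrite pow2_abs.
have := pow2_ge_0 (Rabs x - Rabs y); nra.
Qed.

Lemma sdiff_Cexp z : sdiff Cexp z (Cexp z).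
Proof.
have one h : Cmod h <= / 8 -> Cmod (Cexp h - 1) <= 2 * Cmod h.
  move=> hh; have := Cexp_sub1_sub_bound h ltac:(lra) => B.
  have := Cmod_triangle (Cexp h - 1 - h) h.
  have -> : (Cexp h - 1 - h + h = Cexp h - 1)%C by ring.
  have := Cmod_ge_0 h; nra.
move=> eps he; have M0 := exp_pos (Re z).
set M := exp (Re z) in M0.
set d := Rmin (/ 16) (eps / (100 * M)).
have hq : 0 < eps / (100 * M) by apply: Rdiv_lt_0_compat; lra.
have d1 : d <= / 16 by exact: Rmin_l.
have d2 : M * d <= eps / 100.
  have := Rmult_le_compat_l M _ _ ltac:(lra) (Rmin_r (/ 16) (eps / (100 * M))).
  by have -> : M * (eps / (100 * M)) = eps / 100 by field; lra.
exists d; first by apply: Rmin_glb_lt; lra.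
move=> u v hu hv.
have huv : Cmod (u - v) <= 2 * d.
  by have := Cmod_triangle3 u z v; rewrite (Cmod_sub_sym z v); lra.
have -> : (Cexp u - Cexp v - Cexp z * (u - v) =
  Cexp z * (Cexp (v - z) * (Cexp (u - v) - 1 - (u - v)) + (Cexp (v - z) - 1) * (u - v)))%C.
  have -> : Cexp v = (Cexp z * Cexp (v - z))%C by rewrite -CexpD; congr Cexp; ring.
  have -> : Cexp u = (Cexp z * Cexp (v - z) * Cexp (u - v))%C.
    by rewrite -!CexpD; congr Cexp; ring.
  ring.
rewrite Cmod_mult Cmod_Cexp -/M.
have B1 := Cexp_sub1_sub_bound (u - v) ltac:(lra).
have B2 := one (v - z)%C ltac:(lra).
have B3 : Cmod (Cexp (v - z)) <= 2.
  have := Cmod_triangle (Cexp (v - z) - 1) 1; rewrite Cmod_1.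
  have -> : (Cexp (v - z) - 1 + 1 = Cexp (v - z))%C by ring.
  lra.
have T := Cmod_triangle (Cexp (v - z) * (Cexp (u - v) - 1 - (u - v)))
  ((Cexp (v - z) - 1) * (u - v)).
rewrite !Cmod_mult in T.
have x0 := Cmod_ge_0 (u - v); have y0 := Cmod_ge_0 (v - z).
have C1 : Cmod (Cexp (v - z)) * Cmod (Cexp (u - v) - 1 - (u - v)) <=
  2 * (6 * Cmod (u - v) ^ 2).
  by apply: Rmult_le_compat => //; exact: Cmod_ge_0.
have C2 : Cmod (Cexp (v - z) - 1) * Cmod (u - v) <= 2 * d * Cmod (u - v).
  by apply: Rmult_le_compat_r => //; lra.
have C3 : 2 * (6 * Cmod (u - v) ^ 2) <= 24 * d * Cmod (u - v) by nra.
apply: Rle_trans (_ : M * (26 * d * Cmod (u - v)) <= _).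
  by apply: Rmult_le_compat_l; lra.
have -> : M * (26 * d * Cmod (u - v)) = 26 * (M * d) * Cmod (u - v) by ring.
apply: Rmult_le_compat_r; lra.
Qed.

(** * Cauchy's formula on a family of closed curves *)

Lemma clim_open {T} (F : (T -> Prop) -> Prop) {FF : Filter F} D (g : T -> C) l :
  copen D -> D l -> clim F g l -> F (fun x => D (g x)).
Proof.
move=> oD Dl hg; case: (oD _ Dl) => d d0 hd.
by apply: filter_imp (hg _ d0) => x; apply: hd.
Qed.

(** Differentiability of a path, in the form that composes with [sdiff]. *)
Definition pderiv (p : R -> C) (t : R) (p' : C) := forall eps, 0 < eps ->
  exists2 d, 0 < d & forall s, Rabs (s - t) < d ->
    Cmod (p s - p t - RtoC (s - t) * p')%C <= eps * Rabs (s - t).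

Lemma pderiv_comp f p t a p' : pderiv p t p' -> sdiff f (p t) a ->
  pderiv (fun s => f (p s)) t (a * p')%C.
Proof.
move=> hp hf eps he.
have a0 := Cmod_ge_0 a; have p0 := Cmod_ge_0 p'.
have he1 : 0 < eps / (2 * (Cmod p' + 1)) by apply: Rdiv_lt_0_compat; lra.
have he2 : 0 < eps / (2 * (Cmod a + 1)) by apply: Rdiv_lt_0_compat; lra.
case: (hf _ he1) => d1 d10 hd1; case: (hp _ he2) => d2 d20 hd2.
case: (hp _ Rlt_0_1) => d3 d30 hd3.
have hq : 0 < d1 / (Cmod p' + 1) by apply: Rdiv_lt_0_compat; lra.
exists (Rmin d2 (Rmin d3 (d1 / (Cmod p' + 1)))); first by do! apply: Rmin_glb_lt.
move=> s hs.
have s2 := Rlt_le_trans _ _ _ hs (Rmin_l _ _).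
have s3 := Rlt_le_trans _ _ _ (Rlt_le_trans _ _ _ hs (Rmin_r _ _)) (Rmin_l _ _).
have s1 := Rlt_le_trans _ _ _ (Rlt_le_trans _ _ _ hs (Rmin_r _ _)) (Rmin_r _ _).
have A2 := hd2 _ s2; have A3 := hd3 _ s3.
have x0 := Rabs_pos (s - t).
have L : Cmod (p s - p t) <= (Cmod p' + 1) * Rabs (s - t).
  have := Cmod_lower (p s - p t) (RtoC (s - t) * p'); rewrite Cmod_mult Cmod_R; lra.
have L1 : Cmod (p s - p t) < d1.
  apply: Rle_lt_trans L _.
  have := Rmult_lt_compat_l (Cmod p' + 1) _ _ ltac:(lra) s1.
  by have -> : (Cmod p' + 1) * (d1 / (Cmod p' + 1)) = d1 by field; lra.
have A1 := hd1 (p s) (p t) L1; rewrite Cmod_self in A1; have {}A1 := A1 d10.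
have -> : (f (p s) - f (p t) - RtoC (s - t) * (a * p') =
  (f (p s) - f (p t) - a * (p s - p t)) + a * (p s - p t - RtoC (s - t) * p'))%C by ring.
apply: Rle_trans (Cmod_triangle _ _) _; rewrite Cmod_mult.
have B1 : eps / (2 * (Cmod p' + 1)) * Cmod (p s - p t) <= eps / 2 * Rabs (s - t).
  apply: Rle_trans (Rmult_le_compat_l _ _ _ (Rlt_le _ _ he1) L) _.
  by apply: Req_le; field; lra.
have B2 : Cmod a * Cmod (p s - p t - RtoC (s - t) * p') <= eps / 2 * Rabs (s - t).
  apply: Rle_trans (Rmult_le_compat_l _ _ _ a0 A2) _.
  have -> : Cmod a * (eps / (2 * (Cmod a + 1)) * Rabs (s - t)) =
    (Cmod a / (Cmod a + 1)) * (eps / 2 * Rabs (s - t)) by field; lra.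
  rewrite -[X in _ <= X]Rmult_1_l; apply: Rmult_le_compat_r.
    by apply: Rmult_le_pos; lra.
  by apply/Rcomplements.Rle_div_l; lra.
lra.
Qed.

Lemma pderiv_Re p t p' : pderiv p t p' -> is_derive (fun s => Re (p s)) t (Re p').
Proof.
move=> hp; apply/is_derive_Reals => eps he.
have he2 : 0 < eps / 2 by lra.
case: (hp _ he2) => d d0 hd; exists (mkposreal _ d0) => h h0 /= hh.
have e1 : t + h - t = h by ring.
have := hd (t + h); rewrite e1 => /(_ hh).
have := re_le_Cmod (p (t + h) - p t - RtoC h * p').
have -> : Re (p (t + h) - p t - RtoC h * p') = Re (p (t + h)) - Re (p t) - h * Re p'.
  by rewrite /Re /Im /=; ring.
move=> k1 k2.
have h1 : 0 < Rabs h by exact: Rabs_pos_lt.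
have -> : (Re (p (t + h)) - Re (p t)) / h - Re p' =
  (Re (p (t + h)) - Re (p t) - h * Re p') / h by field.
rewrite Rabs_div //; apply/Rcomplements.Rlt_div_l; nra.
Qed.

Lemma pderiv_pair f g t f' g' : is_derive f t f' -> is_derive g t g' ->
  pderiv (fun s => (f s, g s)) t (f', g').
Proof.
move=> /is_derive_Reals hf /is_derive_Reals hg eps he.
have he2 : 0 < eps / 2 by lra.
case: (hf _ he2) => d1 hd1; case: (hg _ he2) => d2 hd2.
exists (Rmin d1 d2); first by apply: Rmin_glb_lt; exact: cond_pos.
move=> s hs.
have s1 := Rlt_le_trans _ _ _ hs (Rmin_l _ _).
have s2 := Rlt_le_trans _ _ _ hs (Rmin_r _ _).
case: (Req_dec (s - t) 0) => e0.
  have -> : s = t by lra.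
  rewrite (_ : (_ - _ - _ = 0)%C); last by rewrite Rminus_diag; ring.
  by rewrite Cmod_0; apply: Rmult_le_pos; [lra|exact: Rabs_pos].
have := hd1 _ e0 s1; have := hd2 _ e0 s2.
have -> : t + (s - t) = s by ring.
have h1 : 0 < Rabs (s - t) by exact: Rabs_pos_lt.
move=> k2 k1; apply: Rle_trans (Cmod_le_Re_Im _) _; rewrite /Re /Im /=.
have -> : f s + - f t + - ((s - t) * f' - 0 * g') =
  ((f s - f t) / (s - t) - f') * (s - t) by field.
have -> : g s + - g t + - ((s - t) * g' + 0 * f') =
  ((g s - g t) / (s - t) - g') * (s - t) by field.
rewrite !Rabs_mult; nra.
Qed.

(** The curves used are the images under the exponential of these arcs; the
    image is closed, with a corner at [t = 0] when [c <> 0]. *)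
Definition arc (a c t : R) : C := (a + c * sin (t / 2), t).
Definition darc (c t : R) : C := (c / 2 * cos (t / 2), 1).

Lemma pderiv_arc a c t : pderiv (arc a c) t (darc c t).
Proof. by apply: pderiv_pair; auto_derive => //; rewrite /Rdiv; ring. Qed.

Lemma clim_arc a c t : clim (locally t) (arc a c) (arc a c t).
Proof.
apply: clim_pair; last exact: filterlim_id.
apply: (ex_derive_continuous (fun t => a + c * sin (t / 2))).
by auto_derive.
Qed.

Lemma clim_darc c t : clim (locally t) (darc c) (darc c t).
Proof.
apply: clim_pair; last exact: filterlim_const.
apply: (ex_derive_continuous (fun t => c / 2 * cos (t / 2))).
by auto_derive.
Qed.

Lemma ccont_Cexp z : ccont Cexp z.
Proof. exact: sdiff_ccont (sdiff_Cexp z). Qed.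

Lemma Cexp_arc_closed a c : Cexp (arc a c (2 * PI)) = Cexp (arc a c 0).
Proof.
rewrite /Cexp /arc /Re /Im /=.
have -> : 2 * PI / 2 = PI by field.
have -> : 0 / 2 = 0 by field.
by rewrite sin_PI sin_0 sin_2PI cos_2PI cos_0.
Qed.

Lemma Rmin_0_2PI : Rmin 0 (2 * PI) = 0.
Proof. by rewrite Rmin_left //; have := PI_RGT_0; lra. Qed.
Lemma Rmax_0_2PI : Rmax 0 (2 * PI) = 2 * PI.
Proof. by rewrite Rmax_right //; have := PI_RGT_0; lra. Qed.

Lemma is_RInt_arc_deriv D f f' a c : copen D -> holo D f f' ->
  (forall t, 0 <= t <= 2 * PI -> D (arc a c t)) ->
  is_RInt (fun t => Re (f' (arc a c t) * darc c t)%C) 0 (2 * PI)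
    (Re (f (arc a c (2 * PI)) - f (arc a c 0))%C).
Proof.
move=> oD hf hD.
have := is_RInt_derive (fun t => Re (f (arc a c t)))
  (fun t => Re (f' (arc a c t) * darc c t)%C) 0 (2 * PI).
rewrite Rmin_0_2PI Rmax_0_2PI; apply => t ht.
  by apply: pderiv_Re; apply: pderiv_comp (pderiv_arc a c t) (hf _ (hD _ ht)).
apply: clim_Re; apply: clim_mult; last exact: clim_darc.
by apply: clim_comp (clim_arc a c t) (holo_deriv_ccont _ _ _ oD hf _ (hD _ ht)).
Qed.

Lemma copen_setT : copen (fun _ => True).
Proof. by move=> z _; exists 1 => //; lra. Qed.

Lemma copen_preim D (g : C -> C) : copen D -> (forall z, ccont g z) ->
  copen (fun z => D (g z)).
Proof.
move=> oD cg z Dz; case: (oD _ Dz) => d d0 hd; case: (cg z _ d0) => e e0 he.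
by exists e => // u hu; apply/hd/he.
Qed.

(** Scaling the curve [g] down to the origin does not change the integral: the
    derivative in [s] of [f (s g) g' / g] is [f' (s g) g'], which is [1 / s] times the
    derivative of [f (s g)] along the closed curve, and has integral 0. *)
Lemma Cauchy_mean_value D f f' a c eta : copen D -> holo D f f' -> 0 < eta ->
  (forall s t, - eta < s < 1 + eta -> 0 <= t <= 2 * PI -> D (s * Cexp (arc a c t))%C) ->
  is_RInt (fun t => Re (f (Cexp (arc a c t)) * darc c t)%C) 0 (2 * PI)
    (Re (RtoC (2 * PI) * Ci * f 0)%C).
Proof.
move=> oD hf eta0 hD.
set g := fun t => Cexp (arc a c t).
have cg t : clim (locally t) g (g t).
  by apply: clim_comp (clim_arc a c t) (ccont_Cexp _).
have cf z : D z -> ccont f z by move=> Dz; apply: sdiff_ccont (hf z Dz).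
have cf' := holo_deriv_ccont _ _ _ oD hf.
set J := fun s t => Re (f (RtoC s * g t) * darc c t)%C.
set J' := fun s t => Re (f' (RtoC s * g t) * g t * darc c t)%C.
have cst s t : clim (locally (s, t)) (fun z : R * R => RtoC z.1 * g z.2)%C (RtoC s * g t)%C.
  apply: clim_mult.
    apply: clim_pair; last exact: filterlim_const.
    exact: continuous_fst.
  have h : clim (locally (s, t)) (fun z : R * R => arc a c z.2) (arc a c t).
    move=> eps he; have [d hd] := clim_arc a c t eps he.
    by exists d => z [_ hz]; apply: hd.
  exact: clim_comp h (ccont_Cexp _).
have dJ s t : D (RtoC s * g t)%C -> is_derive (fun x => J x t) s (J' s t).
  move=> Dst; apply: pderiv_Re.
  have p1 : pderiv (fun x => RtoC x * g t)%C s (g t).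
    move=> eps he; exists 1 => [|x _]; first lra.
    rewrite (_ : (_ - _ - _ = 0)%C); last by rewrite RtoC_minus; ring.
    by rewrite Cmod_0; apply: Rmult_le_pos; [lra|exact: Rabs_pos].
  have p2 := pderiv_comp _ _ _ _ _ p1 (hf _ Dst).
  have := pderiv_comp (fun w => darc c t * w)%C _ _ _ _ p2 (sdiff_scal _ _).
  move=> p3 eps he; case: (p3 eps he) => d d0 hd; exists d => // x hx.
  have := hd x hx; congr (Cmod _ <= _); ring.
have cJ s t : -eta < s < 1 + eta -> 0 <= t <= 2 * PI -> continuous (J s) t.
  move=> hs ht; apply: clim_Re; apply: clim_mult; last exact: clim_darc.
  apply: clim_comp (cf _ (hD _ _ hs ht)).
  by apply: clim_mult => //; exact: clim_const.
have RJ s : -eta < s < 1 + eta -> ex_RInt (J s) 0 (2 * PI).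
  move=> hs; apply: ex_RInt_continuous => t.
  by rewrite Rmin_0_2PI Rmax_0_2PI; apply: cJ.
have IJ' s : -eta < s < 1 + eta -> is_RInt (J' s) 0 (2 * PI) 0.
  move=> hs.
  case: (Req_dec s 0) => s0.
    have := is_RInt_arc_deriv (fun _ => True) (fun u => f' 0 * Cexp u)%C
      (fun u => f' 0 * Cexp u)%C a c copen_setT.
    rewrite Cexp_arc_closed.
    have -> : (f' 0 * Cexp (arc a c 0) - f' 0 * Cexp (arc a c 0) = 0)%C by ring.
    move=> H; apply: is_RInt_ext; last apply: H => //.
      by move=> t _; rewrite /J' s0 Cmult_0_l.
    by move=> z _; apply: sdiff_comp (sdiff_Cexp z) (sdiff_scal _ _).
  have s0' : RtoC s <> 0 by move=> [].
  have cs u : sdiff (fun u => RtoC s * Cexp u)%C u (RtoC s * Cexp u)%C.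
    exact: sdiff_comp (sdiff_Cexp u) (sdiff_scal _ _).
  have := is_RInt_arc_deriv (fun u => D (RtoC s * Cexp u)%C)
    (fun u => / RtoC s * f (RtoC s * Cexp u))%C
    (fun u => / RtoC s * (f' (RtoC s * Cexp u) * (RtoC s * Cexp u)))%C a c.
  rewrite Cexp_arc_closed.
  set X := (/ RtoC s * _)%C; have -> : (X - X = 0)%C by ring.
  move=> H; apply: is_RInt_ext; last apply: H.
  - by move=> t _; rewrite /J' -/(g t); congr Re; field.
  - by apply: copen_preim => // z; apply: sdiff_ccont (cs z).
  - move=> z Dz; apply: (sdiff_comp (fun w => / RtoC s * w)%C).
      by apply: sdiff_comp (cs z) (hf _ Dz).
    exact: sdiff_scal.
  - by move=> t ht; apply: hD.
have dI s : 0 <= s <= 1 -> is_derive (fun x => RInt (J x) 0 (2 * PI)) s 0.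
  move=> hs.
  have loc : locally s (fun x => - eta < x < 1 + eta).
    exists (mkposreal _ eta0) => x; rewrite /ball /= /AbsRing_ball /abs /minus /plus /opp /=.
    by move=> /Rabs_lt_between; lra.
  have hs' : - eta < s < 1 + eta by lra.
  have E0 : RInt (fun t => Derive (fun x => J x t) s) 0 (2 * PI) = 0.
    apply: is_RInt_unique; apply: is_RInt_ext (IJ' s hs').
    rewrite Rmin_0_2PI Rmax_0_2PI => t ht.
    by symmetry; apply: is_derive_unique; apply: dJ; apply: hD; lra.
  suff H : is_derive (fun x => RInt (J x) 0 (2 * PI)) s
    (RInt (fun t => Derive (fun x => J x t) s) 0 (2 * PI)) by rewrite E0 in H.
  apply: (is_derive_RInt_param J 0 (2 * PI) s).
  - apply: filter_imp loc => x hx t; rewrite Rmin_0_2PI Rmax_0_2PI => ht.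
    by exists (J' x t); apply/dJ/hD.
  - move=> t; rewrite Rmin_0_2PI Rmax_0_2PI => ht.
    have Dst := hD _ _ hs' ht.
    apply: (continuity_2d_pt_ext_loc J').
      apply/locally_2d_locally.
      apply: filter_imp (clim_open (locally (s, t)) _ _ _ oD Dst (cst s t)) => z Dz.
      by symmetry; apply: is_derive_unique; exact: dJ.
    apply/continuity_2d_pt_filterlim.
    apply: (clim_Re (locally (s, t)) (fun z : R * R =>
      f' (RtoC z.1 * g z.2) * g z.2 * darc c z.2)%C).
    apply: clim_mult.
      apply: clim_mult; first exact: clim_comp (cst s t) (cf' _ Dst).
      move=> eps he; have [d hd] := cg t eps he.
      by exists d => z [_ hz]; apply: hd.
    move=> eps he; have [d hd] := clim_darc c t eps he.
    by exists d => z [_ hz]; apply: hd.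
  - apply: filter_imp loc => x hx; exact: RJ.
have E := eq_is_derive (fun x => RInt (J x) 0 (2 * PI)) 0 1 dI Rlt_0_1.
have -> : Re (RtoC (2 * PI) * Ci * f 0) = RInt (J 1) 0 (2 * PI).
  rewrite -E; symmetry; apply: is_RInt_unique.
  have := is_RInt_arc_deriv (fun _ => True) (fun u => f 0 * u)%C (fun u => f 0)%C a c copen_setT.
  have -> : (f 0 * arc a c (2 * PI) - f 0 * arc a c 0 = RtoC (2 * PI) * Ci * f 0)%C.
    have -> : arc a c (2 * PI) = (arc a c 0 + RtoC (2 * PI) * Ci)%C.
      rewrite /arc /Ci /RtoC /Cmult /Cplus /=.
      have -> : 2 * PI / 2 = PI by field.
      have -> : 0 / 2 = 0 by field.
      by rewrite sin_PI sin_0; congr pair; ring.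
    by ring.
  move=> H; apply: is_RInt_ext; last apply: H => //.
    by move=> t _; rewrite /J Cmult_0_l.
  by move=> z _; exact: sdiff_scal.
apply: is_RInt_ext; last by apply: RInt_correct; apply: RJ; lra.
by move=> t _; rewrite /J Cmult_1_l.
Qed.

(** * Taylor coefficients as integrals *)

(** In logarithmic coordinates, [w ^ (- n) dw / w] along the curve. *)
Definition kern a c n t : C := (Cexp (- RtoC (INR n) * arc a c t) * darc c t)%C.

(** Cauchy's integral for the coefficient of index [n]. The factor [mu] makes the
    real part of the integral carry the whole complex value. *)
Definition has_coef a c n (f : C -> C) (l : C) := forall mu : C,
  is_RInt (fun t => Re (mu * f (Cexp (arc a c t)) * kern a c n t)%C) 0 (2 * PI)
    (Re (RtoC (2 * PI) * Ci * (mu * l))%C).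

(** The margin [eta] leaves room to differentiate in the scaling factor [s] at
    both ends of [[0, 1]]. *)
Definition curve_in (D : C -> Prop) a c := exists2 eta, 0 < eta &
  forall s t, - eta < s < 1 + eta -> 0 <= t <= 2 * PI -> D (s * Cexp (arc a c t))%C.

Lemma holo_choice (D : C -> Prop) (f : C -> C) :
  (forall z, D z -> exists a, sdiff f z a) -> exists f', holo D f f'.
Proof.
move=> H.
have H' z : exists a, D z -> sdiff f z a.
  case: (Classical_Prop.classic (D z)) => Dz; last by exists 0.
  by case: (H z Dz) => a ha; exists a.
by have [f' hf'] := boolp.choice H'; exists f'.
Qed.

Lemma Cexp_opp_INR_mul n u : (Cexp (- RtoC (INR n) * u) * Cexp u ^ n = 1)%C.
Proof.
elim: n => [|n IH].
  by rewrite /= Cmult_1_r (_ : (- 0 * u = 0)%C) ?Cexp0 //; ring.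
have -> : (- RtoC (INR n.+1) * u = - RtoC (INR n) * u + - u)%C.
  by rewrite S_INR RtoC_plus; ring.
rewrite CexpD /=.
have -> : (Cexp (- RtoC (INR n) * u) * Cexp (- u) * (Cexp u * Cexp u ^ n) =
  (Cexp (- RtoC (INR n) * u) * Cexp u ^ n) * (Cexp (- u) * Cexp u))%C by ring.
rewrite IH -CexpD (_ : (- u + u = 0)%C); last by ring.
by rewrite Cexp0; ring.
Qed.

Lemma Cexp_opp_INR_closed a c n :
  Cexp (- RtoC (INR n) * arc a c (2 * PI))%C = Cexp (- RtoC (INR n) * arc a c 0)%C.
Proof.
have h1 := Cexp_opp_INR_mul n (arc a c (2 * PI)).
have h2 := Cexp_opp_INR_mul n (arc a c 0).
rewrite Cexp_arc_closed in h1.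
have p : (Cexp (arc a c 0) ^ n)%C <> 0.
  by apply: Cpow_nz; exact: Cexp_neq0.
set X := Cexp _ in h1 *; set Y := Cexp (_ * arc a c 0)%C in h2 *.
set Z := (_ ^ n)%C in h1 h2 p.
have -> : X = (X * Z / Z)%C by field.
by rewrite h1 -h2; field.
Qed.

Lemma kernS a c n t : (Cexp (arc a c t) * kern a c n.+1 t = kern a c n t)%C.
Proof.
rewrite /kern Cmult_assoc -CexpD; congr (Cexp _ * _)%C.
by rewrite S_INR RtoC_plus; ring.
Qed.

Lemma sdiff_Cexp_scal k z : sdiff (fun u => Cexp (k * u)%C) z (Cexp (k * z) * k)%C.
Proof. exact: sdiff_comp (sdiff_scal k z) (sdiff_Cexp _). Qed.

Lemma kern_int0 a c n (mu : C) :
  is_RInt (fun t => Re (mu * kern a c n.+1 t)%C) 0 (2 * PI) 0.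
Proof.
set k := (- RtoC (INR n.+1))%C.
have k0 : k <> 0.
  rewrite /k => /(f_equal fst) /=; have := pos_INR n; rewrite -/(INR n.+1) S_INR; lra.
have := is_RInt_arc_deriv (fun _ => True) (fun u => mu / k * Cexp (k * u))%C
  (fun u => mu / k * (Cexp (k * u) * k))%C a c copen_setT.
rewrite (Cexp_opp_INR_closed a c n.+1).
set X := (mu / k * _)%C; have -> : (X - X = 0)%C by ring.
move=> H; apply: is_RInt_ext; last apply: H => //.
  by move=> t _; rewrite /kern -/k; congr Re; field.
move=> z _; apply: (sdiff_comp (fun w => mu / k * w)%C).
  exact: sdiff_Cexp_scal.
exact: sdiff_scal.
Qed.

Lemma has_coef_0 D f a c : copen D -> (forall z, D z -> exists a, sdiff f z a) ->
  curve_in D a c -> has_coef a c 0 f (f 0).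
Proof.
move=> oD hf [eta e0 hD] mu.
have [f' hf'] := holo_choice D f hf.
have hm : holo D (fun z => mu * f z)%C (fun z => mu * f' z)%C.
  by move=> z Dz; apply: (sdiff_comp (fun w => mu * w)%C) (hf' z Dz) (sdiff_scal _ _).
apply: is_RInt_ext (Cauchy_mean_value D _ _ a c eta oD hm e0 hD) => t _.
by rewrite /kern (_ : (- RtoC (INR 0) * _ = 0)%C) ?Cexp0; [congr Re; ring|rewrite [INR 0]/=; ring].
Qed.

Lemma is_pseries_at0 (b : nat -> C) (l : C) :
  @is_pseries C_AbsRing C_NormedModule b (RtoC 0) l -> l = b 0%N.
Proof.
move=> h.
have h0 := @is_pseries_0 C_AbsRing C_NormedModule b.
exact: (@filterlim_locally_unique nat C_AbsRing C_NormedModule eventually _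
  (sum_n (fun k => scal (pow_n (RtoC 0) k) (b k))) l (b 0%N) h h0).
Qed.

(** Writing [f = b 0 + w H(w)], the constant contributes nothing to the
    coefficient of positive index, being an exact derivative. *)
Lemma has_coef_pseries D a c n f b (r : posreal) : copen D ->
  (forall z, D z -> exists a, sdiff f z a) -> curve_in D a c ->
  (forall x, Cmod x < r -> @is_pseries C_AbsRing C_NormedModule b x (f x)) ->
  has_coef a c n f (b n).
Proof.
move=> oD hf cD; have r0 := cond_pos r.
elim: n f b hf => [|n IH] f b hf hs.
  rewrite -(is_pseries_at0 b (f 0)); first exact: has_coef_0 oD hf cD.
  by apply: hs; rewrite Cmod_0.
set H := fun w : C => if Req_dec_T (Cmod w) 0 then b 1%N else ((f w - b 0%N) / w)%C.
have H0 (w : C) : w <> 0 -> H w = ((f w - b 0%N) / w)%C.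
  by move=> w0; rewrite /H; case: Req_dec_T => // e; case: w0; exact: Cmod_eq_0.
have Hs x : Cmod x < r ->
  @is_pseries C_AbsRing C_NormedModule (fun n => b n.+1) x (H x).
  move=> hx; rewrite /H; case: Req_dec_T => e /=.
    rewrite (Cmod_eq_0 _ e).
    exact: (@is_pseries_0 C_AbsRing C_NormedModule (fun n => b n.+1)).
  have x0 : x <> 0 by move=> x0; case: e; rewrite x0 Cmod_0.
  have -> : ((f x - b 0%N) / x = scal (/ x)%C (plus (f x) (opp (b 0%N)) : C_NormedModule))%C.
    by rewrite /scal /= /mult /= /plus /opp /=; field.
  apply: (@is_pseries_decr_1 C_AbsRing C_NormedModule b x (/ x)%C) (hs x hx).
  by rewrite /mult /= /one /=; field.
have Hd z : D z -> exists a, sdiff H z a.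
  move=> Dz; case: (Classical_Prop.classic (z = 0)) => z0.
    apply: analytic_at_sdiff; exists (fun n => b n.+1), r => x.
    by rewrite z0 (_ : (x - 0 = x)%C); [exact: Hs|ring].
  case: (hf z Dz) => d hd; have z0' : 0 < Cmod z by apply/Cmod_gt_0.
  eexists; apply: (sdiff_ext_loc (fun w => (f w + - b 0%N) * / w)%C _ _ _ (Cmod z) z0').
    move=> w hw; rewrite H0 // => w0; move: hw; rewrite w0 Cmod_sub_sym.
    by rewrite (_ : (z - 0 = z)%C); [lra|ring].
  apply: (sdiff_mult (fun w => (f w + - b 0%N))%C Cinv); last exact: sdiff_inv.
  by apply: (sdiff_plus f (fun _ => - b 0%N)%C); [exact: hd|exact: sdiff_const].
move=> mu.
have := is_RInt_plus _ _ _ _ _ _ (kern_int0 a c n (mu * b 0%N)%C) (IH H _ Hd Hs mu).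
rewrite plus_zero_l => E; apply: is_RInt_ext E => t _.
have e0 := Cexp_neq0 (arc a c t).
rewrite H0 // -(kernS a c n).
set A := (X in plus (Re X) _); set B := (X in plus _ (Re X)).
by rewrite -[plus _ _]/(Re (A + B)%C) /A /B; congr Re; field.
Qed.

(** * Powers of [1 - w] *)

Definition Clog (z : C) : C := (ln (Cmod z), Arg z).

Lemma CpowerE z al : Cpower z al = Cexp (RtoC al * Clog z)%C.
Proof.
by rewrite /Cpower /Cexp /Clog /Rpower /RtoC /Cmult /Re /Im /=; congr pair; rewrite !Rmult_0_l ?Rminus_0_r ?Rplus_0_r.
Qed.

Lemma Cmod2_ReIm (z : C) : Cmod z * Cmod z = Re z * Re z + Im z * Im z.
Proof. by have := Cmod2_alt z; rewrite /= !Rmult_1_r. Qed.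

Lemma Cexp_Clog (z : C) : z <> 0 -> Cexp (Clog z) = z.
Proof.
move=> z0; have m0 : 0 < Cmod z by apply/Cmod_gt_0.
have E := Cmod2_ReIm z.
have R1 := re_le_Cmod z.
have b : -1 <= Re z / Cmod z <= 1.
  move/Rabs_le_between: R1 => R1.
  by split; [apply/Rcomplements.Rle_div_r|apply/Rcomplements.Rle_div_l]; lra.
have S : Cmod z * sqrt (1 - (Re z / Cmod z)²) = Rabs (Im z).
  have -> : 1 - (Re z / Cmod z)² = (Im z / Cmod z)².
    rewrite /Rsqr.
    have e2 : Im z * Im z = Cmod z * Cmod z - Re z * Re z by lra.
    have -> : Im z / Cmod z * (Im z / Cmod z) = (Im z * Im z) / (Cmod z * Cmod z).
      by field; lra.
    by rewrite e2; field; lra.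
  rewrite sqrt_Rsqr_abs Rabs_div; last lra.
  by rewrite (Rabs_pos_eq (Cmod z)); [field|]; lra.
suff [e1 e2] : Cmod z * cos (Arg z) = Re z /\ Cmod z * sin (Arg z) = Im z.
  change ((exp (ln (Cmod z)) * cos (Arg z), exp (ln (Cmod z)) * sin (Arg z)) = z).
  by rewrite exp_ln // e1 e2 -surjective_pairing.
rewrite /Arg; case: Req_dec_T => h; first lra.
split.
  by case: Rle_dec => hi; rewrite ?cos_neg cos_acos //; field.
case: Rle_dec => hi; rewrite ?sin_neg sin_acos //.
  by rewrite S Rabs_pos_eq.
have -> : Cmod z * - sqrt (1 - (Re z / Cmod z)²) = - (Cmod z * sqrt (1 - (Re z / Cmod z)²)) by ring.
by rewrite S Rabs_left; lra.
Qed.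

Lemma cos_2atan t : cos (2 * atan t) = (1 - t * t) / (1 + t * t).
Proof.
have p : 0 < 1 + t * t by nra.
rewrite cos_2a_cos cos_atan /Rsqr.
have -> : 2 * (1 / sqrt (1 + t * t)) * (1 / sqrt (1 + t * t)) - 1 =
  2 / (sqrt (1 + t * t) * sqrt (1 + t * t)) - 1.
  by field; have := sqrt_lt_R0 _ p; lra.
by rewrite sqrt_sqrt; [field|]; lra.
Qed.

Definition slit_plane (z : C) := 0 < Cmod z + Re z.

Lemma slit_plane_neq0 (z : C) : slit_plane z -> z <> 0.
Proof. by rewrite /slit_plane => h e; move: h; rewrite e Cmod_0 /Re /=; lra. Qed.

(** Half-angle formula: unlike the case distinction with [acos], it is
    manifestly continuous on the whole slit plane. *)
Lemma Arg_atan (z : C) : slit_plane z -> Arg z = 2 * atan (Im z / (Cmod z + Re z)).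
Proof.
move=> hz; have z0 := slit_plane_neq0 z hz.
have m0 : 0 < Cmod z by apply/Cmod_gt_0.
rewrite /slit_plane in hz.
have E := Cmod2_ReIm z.
set t := Im z / _.
have C : cos (2 * atan t) = Re z / Cmod z.
  rewrite cos_2atan.
  have -> : 1 - t * t = ((Cmod z + Re z) * (Cmod z + Re z) - Im z * Im z) /
     ((Cmod z + Re z) * (Cmod z + Re z)) by rewrite /t; field; lra.
  have -> : 1 + t * t = ((Cmod z + Re z) * (Cmod z + Re z) + Im z * Im z) /
     ((Cmod z + Re z) * (Cmod z + Re z)) by rewrite /t; field; lra.
  have -> : (Cmod z + Re z) * (Cmod z + Re z) - Im z * Im z =
    2 * Re z * (Cmod z + Re z) by nra.
  have -> : (Cmod z + Re z) * (Cmod z + Re z) + Im z * Im z =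
    2 * Cmod z * (Cmod z + Re z) by nra.
  field; lra.
have B := atan_bound t.
rewrite /Arg; case: Req_dec_T => h; first lra.
rewrite -C; case: Rle_dec => hi.
  apply: acos_cos; split; last lra.
  have : 0 <= atan t.
    case: (Req_dec (Im z) 0) => e.
      by rewrite /t e /Rdiv Rmult_0_l atan_0; lra.
    rewrite -atan_0; apply/Rlt_le/atan_increasing; apply: Rdiv_lt_0_compat; lra.
  lra.
rewrite -cos_neg acos_cos /=; first lra.
have : atan t < 0.
  rewrite -atan_0; apply: atan_increasing; rewrite /t /Rdiv.
  have := Rinv_0_lt_compat _ hz; nra.
lra.
Qed.

Lemma ccont_continuous_pair (g1 g2 : C -> R) (z : C) :
  continuous (T := C_UniformSpace) g1 z -> continuous (T := C_UniformSpace) g2 z ->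
  ccont (fun w => (g1 w, g2 w)) z.
Proof.
move=> h1 h2 eps he.
have [d hd] := clim_pair (locally (T := C_UniformSpace) z) g1 g2 _ _ h1 h2 eps he.
exists d => [|u hu]; first exact: cond_pos.
by apply: hd; apply: C_NormedModule_mixin_compat1.
Qed.

Lemma continuous_Cmod z : continuous (T := C_UniformSpace) Cmod z.
Proof.
apply: (continuous_comp (U := C_UniformSpace) (fun w : C => w.1 ^ 2 + w.2 ^ 2) sqrt).
  apply: (continuous_plus (U := C_UniformSpace)).
  - apply: (continuous_comp (U := C_UniformSpace) (fun w : C => w.1) (fun x => x ^ 2)).
      exact: continuous_fst.
    by apply: ex_derive_continuous; auto_derive.
  - apply: (continuous_comp (U := C_UniformSpace) (fun w : C => w.2) (fun x => x ^ 2)).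
      exact: continuous_snd.
    by apply: ex_derive_continuous; auto_derive.
exact: continuous_sqrt.
Qed.

Lemma copen_slit_plane : copen slit_plane.
Proof.
move=> z hz; rewrite /slit_plane in hz.
exists ((Cmod z + Re z) / 2) => [|u hu]; first lra.
have := Cmod_lower z u; rewrite (Cmod_sub_sym z u) => h1.
have /Rabs_le_between h2 := re_le_Cmod (u - z)%C.
move: h2; rewrite /slit_plane /Re /=; rewrite /Re in hu hz; lra.
Qed.

Lemma ccont_Clog z : slit_plane z -> ccont Clog z.
Proof.
move=> hz.
have m0 : 0 < Cmod z by apply/Cmod_gt_0; exact: slit_plane_neq0.
have H : ccont (fun w : C => (ln (Cmod w), 2 * atan (Im w / (Cmod w + Re w)))) z.
  apply: ccont_continuous_pair.
    apply: (continuous_comp (U := C_UniformSpace) Cmod ln); first exact: continuous_Cmod.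
    by apply: ex_derive_continuous; exists (/ Cmod z); exact: is_derive_ln.
  apply: (continuous_comp (U := C_UniformSpace) (fun w => Im w / (Cmod w + Re w))
    (fun x => 2 * atan x)); last by apply: ex_derive_continuous; auto_derive.
  apply: (continuous_mult (U := C_UniformSpace) (K := R_AbsRing) (fun w : C => Im w)
    (fun w => / (Cmod w + Re w))); first exact: continuous_snd.
  apply: (continuous_comp (U := C_UniformSpace) (fun w => Cmod w + Re w) Rinv).
    apply: (continuous_plus (U := C_UniformSpace) Cmod); first exact: continuous_Cmod.
    exact: continuous_fst.
  apply: ex_derive_continuous; auto_derive; rewrite /slit_plane in hz; lra.
case: (copen_slit_plane z hz) => d d0 hd.
move=> eps he; case: (H eps he) => d' d0' hd'.
exists (Rmin d d'); first exact: Rmin_glb_lt.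
move=> u hu.
have hu1 := Rlt_le_trans _ _ _ hu (Rmin_l _ _).
have hu2 := Rlt_le_trans _ _ _ hu (Rmin_r _ _).
rewrite /Clog !Arg_atan //; [exact: hd'|exact: hd].
Qed.

(** With [p = g u] and [q = g v], the estimate [f p - f q = a (p - q) + o(p - q)]
    reads [u - v = a (p - q) + o(p - q)], and can be solved for [p - q]. *)
Lemma sdiff_local_inverse f g (z a : C) d0 : a <> 0 -> sdiff f (g z) a -> ccont g z ->
  0 < d0 -> (forall u, Cmod (u - z) < d0 -> f (g u) = u) -> sdiff g z (/ a)%C.
Proof.
move=> a0 hf cg d00 fg eps he.
have m0 : 0 < Cmod a by apply/Cmod_gt_0.
set m := Cmod a in m0.
set e := Rmin (m / 2) (eps * m * m / 2).
have e0 : 0 < e.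
  apply: Rmin_glb_lt; first lra.
  by have := Rmult_lt_0_compat _ _ (Rmult_lt_0_compat _ _ he m0) m0; lra.
have e1 : e <= m / 2 by exact: Rmin_l.
have e2 : e <= eps * m * m / 2 by exact: Rmin_r.
case: (hf _ e0) => d d1 hd; case: (cg _ d1) => d' d1' hd'.
exists (Rmin d0 d'); first exact: Rmin_glb_lt.
move=> u v hu hv.
have hu1 := Rlt_le_trans _ _ _ hu (Rmin_l _ _).
have hu2 := Rlt_le_trans _ _ _ hu (Rmin_r _ _).
have hv1 := Rlt_le_trans _ _ _ hv (Rmin_l _ _).
have hv2 := Rlt_le_trans _ _ _ hv (Rmin_r _ _).
have := hd _ _ (hd' _ hu2) (hd' _ hv2); rewrite !fg //.
set p := g u; set q := g v => A.
have x0 := Cmod_ge_0 (u - v); have y0 := Cmod_ge_0 (p - q).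
have L : m / 2 * Cmod (p - q) <= Cmod (u - v).
  have := Cmod_lower (a * (p - q)) (u - v); rewrite (Cmod_sub_sym (a * (p - q)) (u - v)) Cmod_mult -/m; nra.
have -> : (p - q - / a * (u - v) = - ((u - v - a * (p - q)) / a))%C by field.
rewrite Cmod_opp Cmod_div // -/m; apply/Rcomplements.Rle_div_l => //.
apply: Rle_trans A _.
apply: (Rmult_le_reg_l (m / 2)); first lra.
have : e * (m / 2 * Cmod (p - q)) <= eps * m * m / 2 * Cmod (u - v).
  by apply: Rmult_le_compat; lra || nra.
nra.
Qed.

Lemma sdiff_Clog z : slit_plane z -> sdiff Clog z (/ z)%C.
Proof.
move=> hz; have z0 := slit_plane_neq0 z hz.
case: (copen_slit_plane z hz) => d d0 hd.
apply: (sdiff_local_inverse Cexp Clog z z d) => //.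
- by rewrite -{2}(Cexp_Clog z z0); exact: sdiff_Cexp.
- exact: ccont_Clog.
- by move=> u hu; apply: Cexp_Clog; apply/slit_plane_neq0/hd.
Qed.

Definition pow1m al (w : C) : C := Cpower (1 - w)%C al.

Lemma sdiff_pow1m al w : slit_plane (1 - w)%C ->
  sdiff (pow1m al) w (- RtoC al * pow1m al w / (1 - w))%C.
Proof.
move=> hw; have w0 := slit_plane_neq0 _ hw.
have s1 : sdiff (fun w => 1 - w)%C w (0 + (- 1))%C.
  apply: (sdiff_ext (fun w => 1 + (- 1) * w)%C); first by move=> v; ring.
  by apply: (sdiff_plus (fun _ => RtoC 1)); [exact: sdiff_const|exact: sdiff_scal].
have s2 := sdiff_comp _ _ _ _ _ s1 (sdiff_Clog _ hw).
have s3 := sdiff_comp _ _ _ _ _ s2 (sdiff_Cexp_scal (RtoC al) _).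
apply: (sdiff_ext _ _ _ _ (fun v => esym (CpowerE _ al))).
apply: sdiff_eq s3; rewrite /pow1m CpowerE; field; exact: w0.
Qed.

Lemma pow1m_0 al : pow1m al 0 = 1.
Proof.
have -> : pow1m al 0 = Cpower 1 al by rewrite /pow1m; congr Cpower; ring.
rewrite CpowerE (_ : Clog 1 = 0) ?Cmult_0_r ?Cexp0 //.
rewrite /Clog Cmod_1 ln_1 Arg_atan /slit_plane ?Cmod_1 /Re /Im /=; last lra.
by rewrite /Rdiv Rmult_0_l atan_0 Rmult_0_r.
Qed.

(** The coefficients of [(1 - w) ^ al], that is [(-1)^n] times the binomial
    coefficient of [al] over [n]. *)
Fixpoint bin_coef (al : R) (n : nat) : R :=
  if n is m.+1 then bin_coef al m * (INR m - al) / INR m.+1 else 1.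

(** The integrals satisfy the recurrence of the binomial coefficients because
    [(1 - w)^(1 + al) w^-(n+1)] has no increment along a closed curve; no
    power series is involved. *)
Lemma has_coef_pow1m D a c n al : copen D -> curve_in D a c ->
  (forall w, D w -> slit_plane (1 - w)%C) ->
  has_coef a c n (pow1m al) (RtoC (bin_coef al n)).
Proof.
move=> oD cD hD.
elim: n => [|n IH].
  rewrite /= -(pow1m_0 al); apply: has_coef_0 oD _ cD => z Dz.
  by eexists; apply: sdiff_pow1m; exact: hD.
move=> mu.
have n0 : INR n.+1 <> 0 by apply: not_0_INR.
have n0' : RtoC (INR n.+1) <> 0 by move=> [].
set k := (- RtoC (INR n.+1))%C.
set nu := (mu / RtoC (INR n.+1))%C.
pose D' u := D (Cexp u).
have oD' : copen D' by apply: copen_preim => // z; exact: ccont_Cexp.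
pose P u := pow1m al (Cexp u).
pose Phi u := (nu * ((1 - Cexp u) * (P u * Cexp (k * u))))%C.
pose Phi' u := (nu * ((0 + - 1 * Cexp u) * (P u * Cexp (k * u)) + (1 - Cexp u) *
  ((- RtoC al * P u / (1 - Cexp u) * Cexp u) * Cexp (k * u) + P u * (Cexp (k * u) * k))))%C.
have hPhi : holo D' Phi Phi'.
  move=> z Dz; apply: (sdiff_comp (fun w => nu * w)%C); last exact: sdiff_scal.
  apply: (sdiff_mult (fun u => 1 - Cexp u)%C).
    apply: (sdiff_ext (fun w => 1 + (- 1) * Cexp w)%C); first by move=> v; ring.
    apply: (sdiff_plus (fun _ => RtoC 1)); first exact: sdiff_const.
    exact: sdiff_comp (sdiff_Cexp z) (sdiff_scal _ _).
  apply: (sdiff_mult P); last exact: sdiff_Cexp_scal.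
  by apply: sdiff_comp (sdiff_Cexp z) _; apply: sdiff_pow1m; exact: hD.
have DD t : 0 <= t <= 2 * PI -> D (Cexp (arc a c t)).
  move=> ht; case: cD => eta e0 /(_ 1 t ltac:(lra) ht).
  by rewrite Cmult_1_l.
have F := is_RInt_arc_deriv D' Phi Phi' a c oD' hPhi DD.
have {F} : is_RInt (fun t => Re (Phi' (arc a c t) * darc c t)%C) 0 (2 * PI) 0.
  move: F; rewrite /Phi /P Cexp_arc_closed /k (Cexp_opp_INR_closed a c n.+1).
  by set X := (nu * _)%C; have -> : (X - X = 0)%C by ring.
move=> F.
have := is_RInt_minus _ _ _ _ _ _ (IH (mu * RtoC ((INR n - al) / INR n.+1))%C) F.
have -> : minus (Re (RtoC (2 * PI) * Ci * (mu * RtoC ((INR n - al) / INR n.+1) * RtoC (bin_coef al n)))%C) 0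
  = Re (RtoC (2 * PI) * Ci * (mu * RtoC (bin_coef al n.+1)))%C.
  have -> : (mu * RtoC ((INR n - al) / INR n.+1) * RtoC (bin_coef al n) =
    mu * RtoC (bin_coef al n.+1))%C.
    rewrite -[bin_coef al n.+1]/(bin_coef al n * (INR n - al) / INR n.+1).
    by rewrite !RtoC_div // !RtoC_mult; field.
  exact: Rminus_0_r.
move=> G; apply: is_RInt_ext G => t; rewrite Rmin_0_2PI Rmax_0_2PI => ht.
set A := (X in minus (Re X) _); set B := (X in minus _ (Re X)).
rewrite -[minus _ _]/(Re (A - B)%C) /A /B; congr Re.
have w0 := slit_plane_neq0 _ (hD _ (DD t ltac:(lra))).
have -> : kern a c n t = (Cexp (arc a c t) * kern a c n.+1 t)%C by rewrite kernS.
rewrite /Phi' /P /kern -/k /nu /k RtoC_div // RtoC_minus S_INR RtoC_plus.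
field; split; first by exact: w0.
by move: n0'; rewrite S_INR RtoC_plus.
Qed.

(** * The curve around the slit *)

(** Up to scaling by [rho] and with [k = cos phi], the interiors of [closed_disc]
    and [slit_disc]: the condition on the argument of [w - 1] becomes a condition
    on its cosine. *)
Definition open_disc delta (w : C) := Cmod w < 1 + delta.
Definition slit_domain delta k (w : C) :=
  open_disc delta w /\ Re (w - 1)%C < k * Cmod (w - 1)%C.

Lemma copen_open_disc delta : copen (open_disc delta).
Proof.
move=> w; rewrite /open_disc => hw; exists (1 + delta - Cmod w) => [|u hu]; first lra.
have := Cmod_lower u w; lra.
Qed.

Lemma copen_slit_domain delta k : 0 < k < 1 -> copen (slit_domain delta k).
Proof.
move=> hk w [h1 h2]; case: (copen_open_disc delta w h1) => d d0 hd.
set e := k * Cmod (w - 1) - Re (w - 1).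
exists (Rmin d (e / 2)); first by apply: Rmin_glb_lt => //; rewrite /e; lra.
move=> u hu.
have hu1 := Rlt_le_trans _ _ _ hu (Rmin_l _ _).
have hu2 := Rlt_le_trans _ _ _ hu (Rmin_r _ _).
split; first exact: hd.
have /Rabs_le_between r := re_le_Cmod (u - w)%C.
have l := Cmod_lower (w - 1) (u - 1).
have e1 : (w - 1 - (u - 1) = w - u)%C by ring.
rewrite e1 (Cmod_sub_sym w u) in l.
have e2 : Re (u - 1) = Re (u - w) + Re (w - 1) by rewrite /Re /=; ring.
rewrite e2; rewrite {1}/e in hu2; nra.
Qed.

Lemma slit_domain_slit_plane delta k w : 0 < k < 1 -> slit_domain delta k w ->
  slit_plane (1 - w)%C.
Proof.
move=> hk [_ h]; rewrite /slit_plane (Cmod_sub_sym 1 w).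
have -> : Re (1 - w) = - Re (w - 1) by rewrite /Re /=; ring.
have := Cmod_ge_0 (w - 1); nra.
Qed.

Lemma slit_domain_unit_disc delta k w : 0 < delta -> 0 < k -> Cmod w < 1 ->
  slit_domain delta k w.
Proof.
move=> hd hk hw; split; first by rewrite /open_disc; lra.
have /Rabs_le_between r := re_le_Cmod w.
have -> : Re (w - 1) = Re w - 1 by rewrite /Re /=; ring.
have := Cmod_ge_0 (w - 1); nra.
Qed.

Lemma cos_half t : cos t = 1 - 2 * (sin (t / 2) * sin (t / 2)).
Proof.
transitivity (cos (2 * (t / 2))); first by congr cos; field.
by rewrite cos_2a_sin; ring.
Qed.

Lemma exp_le_exp x y : x <= y -> exp x <= exp y.
Proof. by case=> [h|->]; [apply/Rlt_le/exp_increasing|apply: Rle_refl]. Qed.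

Lemma Re_Cexp_arc_sub1 a c t :
  Re (Cexp (arc a c t) - 1)%C =
  (exp (a + c * sin (t / 2)) - 1) -
  2 * exp (a + c * sin (t / 2)) * (sin (t / 2) * sin (t / 2)).
Proof. by rewrite /Cexp /arc /Re /Im /= cos_half; ring. Qed.

Lemma Cmod2_Cexp_arc_sub1 a c t :
  Cmod (Cexp (arc a c t) - 1) * Cmod (Cexp (arc a c t) - 1) =
  (exp (a + c * sin (t / 2)) - 1) ^ 2 +
  4 * exp (a + c * sin (t / 2)) * (sin (t / 2) * sin (t / 2)).
Proof.
rewrite Cmod2_ReIm Re_Cexp_arc_sub1.
have -> : Im (Cexp (arc a c t) - 1) = exp (a + c * sin (t / 2)) * sin t.
  by rewrite /Cexp /arc /Re /Im /=; ring.
set p := exp _; set s := sin (t / 2).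
have e : sin t * sin t = 1 - cos t * cos t.
  by have := sin2_cos2 t; rewrite /Rsqr; lra.
have -> : p * sin t * (p * sin t) = p * p * (sin t * sin t) by ring.
by rewrite e cos_half -/s; ring.
Qed.

Lemma sin_half_bounds t : 0 <= t <= 2 * PI -> 0 <= sin (t / 2) <= 1.
Proof.
move=> ht; split; last by have := SIN_bound (t / 2); lra.
by apply: sin_ge_0; lra.
Qed.

Lemma exp_le_1_2x x : 0 <= x <= / 2 -> exp x <= 1 + 2 * x.
Proof.
move=> hx; apply: Rle_trans (exp_le_inv x ltac:(lra)) _.
apply: (Rmult_le_reg_l (1 - x)); first lra.
rewrite Rinv_r; last lra; nra.
Qed.

(** The curve leaves the disc of radius 1 so slowly that it stays out of the
    sector: outside the disc its distance to 1 is at least [2 sin (t/2)], its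
    radius exceeds 1 by less than [2 c sin (t/2)], and [c <= k]. *)
Lemma arc_in_slit_domain delta k a c t : 0 < delta -> 0 < k < 1 -> a < 0 -> 0 < c ->
  c <= k -> c <= / 2 -> exp c <= 1 + delta -> 0 <= t <= 2 * PI ->
  slit_domain delta k (Cexp (arc a c t)).
Proof.
move=> hd hk ha hc hck hc2 hcd ht; have hs := sin_half_bounds t ht.
split.
  rewrite /open_disc Cmod_Cexp; apply: Rlt_le_trans hcd.
  by apply: exp_increasing; rewrite /arc /Re /=; nra.
rewrite Re_Cexp_arc_sub1.
have E := Cmod2_Cexp_arc_sub1 a c t.
move: E; set s := sin (t / 2) in hs *; set p := exp (a + c * s); set m := Cmod _ => E.
have m0 : 0 <= m by exact: Cmod_ge_0.
have p0 : 0 < p by exact: exp_pos.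
case: (Rle_lt_dec p 1) => hp.
  have : 0 < m.
    have : 0 < m * m; last by nra.
    rewrite E; case: (Req_dec s 0) => s0; last first.
      have s1 : 0 < s by lra.
      have := Rmult_lt_0_compat _ _ p0 (Rmult_lt_0_compat _ _ s1 s1).
      have := pow2_ge_0 (p - 1); lra.
    have : p < 1 by rewrite -exp_0; apply: exp_increasing; rewrite s0; lra.
    by nra.
  by nra.
have s0 : 0 < s.
  case: (Req_dec s 0) => s0; last lra.
  have : p < 1 by rewrite -exp_0; apply: exp_increasing; rewrite s0; lra.
  lra.
have hm : 2 * s <= m by nra.
have hp2 : p < 1 + 2 * (c * s).
  apply: Rlt_le_trans (exp_le_1_2x (c * s) ltac:(nra)).
  by apply: exp_increasing; lra.
nra.
Qed.

Lemma scal_Cexp_arc s a c t : 0 < s ->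
  (RtoC s * Cexp (arc a c t))%C = Cexp (arc (a + ln s) c t).
Proof.
move=> hs; have -> : arc (a + ln s) c t = (RtoC (ln s) + arc a c t)%C.
  by rewrite /arc /Cplus /=; congr pair; ring.
rewrite CexpD; congr (_ * _)%C.
by rewrite /Cexp /RtoC /Re /Im /= exp_ln // cos_0 sin_0 Rmult_1_r Rmult_0_r.
Qed.

(** Scaling by [s > 0] changes [a] into [a + ln s], which stays negative for [s]
    slightly larger than 1; for [s <= 0] close to 0 the scaled curve lies in the
    unit disc. *)
Lemma curve_in_slit_domain delta k a c : 0 < delta -> 0 < k < 1 -> a < 0 -> 0 < c ->
  c <= k -> c <= / 2 -> exp c <= 1 + delta -> curve_in (slit_domain delta k) a c.
Proof.
move=> hd hk ha hc hck hc2 hcd.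
have e1 : 1 < exp (- a) by rewrite -exp_0; apply: exp_increasing; lra.
have i0 : 0 < / (1 + delta) by apply: Rinv_0_lt_compat; lra.
exists (Rmin (exp (- a) - 1) (/ (1 + delta))); first by apply: Rmin_glb_lt; lra.
move=> s t [hs1 hs2] ht.
have l1 := Rmin_l (exp (- a) - 1) (/ (1 + delta)).
have l2 := Rmin_r (exp (- a) - 1) (/ (1 + delta)).
case: (Rle_lt_dec s 0) => hs.
  apply: slit_domain_unit_disc => //; first lra.
  rewrite Cmod_mult Cmod_R Rabs_left1 //.
  have [h _] := arc_in_slit_domain delta k a c t hd hk ha hc hck hc2 hcd ht.
  rewrite /open_disc in h.
  have g0 := Cmod_ge_0 (Cexp (arc a c t)).
  have : - s * Cmod (Cexp (arc a c t)) <= - s * (1 + delta) by nra.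
  have : - s * (1 + delta) < / (1 + delta) * (1 + delta) by nra.
  by rewrite Rinv_l; lra.
rewrite scal_Cexp_arc //; apply: arc_in_slit_domain => //.
have : ln s < - a by rewrite -(ln_exp (- a)); apply: ln_increasing; lra.
lra.
Qed.

Lemma curve_in_open_disc delta c : 0 < c -> exp c < 1 + delta ->
  curve_in (open_disc delta) c 0.
Proof.
move=> hc hcd; have e0 := exp_pos c.
have q : 1 < (1 + delta) / exp c by apply/Rcomplements.Rlt_div_r; lra.
exists (Rmin 1 ((1 + delta) / exp c - 1)); first by apply: Rmin_glb_lt; lra.
move=> s t [hs1 hs2] ht.
have l1 := Rmin_l 1 ((1 + delta) / exp c - 1).
have l2 := Rmin_r 1 ((1 + delta) / exp c - 1).
rewrite /open_disc Cmod_mult Cmod_R Cmod_Cexp.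
have -> : Re (arc c 0 t) = c by rewrite /arc /Re /=; ring.
have hs : Rabs s < (1 + delta) / exp c.
  by apply/Rabs_lt_between; lra.
have := Rmult_lt_compat_r _ _ _ e0 hs.
by have -> : (1 + delta) / exp c * exp c = 1 + delta by field; lra.
Qed.

Lemma curve_in_mono (D D' : C -> Prop) a c : (forall w, D w -> D' w) ->
  curve_in D a c -> curve_in D' a c.
Proof. by move=> h [eta e0 H]; exists eta => // s t hs ht; apply/h/H. Qed.

Lemma le_of_sq_le x y : 0 <= y -> x * x <= y * y -> x <= y.
Proof. by move=> hy h; apply: Rsqr_incr_0_var. Qed.

(** With [a = - tau], the distance from the curve to 1 is comparable to
    [tau + sin (t/2)]. *)
Lemma arc_dist tau c t : 0 < tau <= 1 -> 0 < c <= / 2 -> 0 <= t <= 2 * PI ->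
  (tau + sin (t / 2)) / 6 <= Cmod (1 - Cexp (arc (- tau) c t))
   <= 6 * (tau + sin (t / 2)).
Proof.
move=> htau hc ht; have hs := sin_half_bounds t ht.
have E := Cmod2_Cexp_arc_sub1 (- tau) c t.
rewrite Cmod_sub_sym.
move: E; set s := sin (t / 2) in hs *; set p := exp (- tau + c * s); set m := Cmod _ => E.
have m0 : 0 <= m by exact: Cmod_ge_0.
have p0 : 0 < p by exact: exp_pos.
have p3 : / 3 <= p.
  apply: Rle_trans (_ : exp (- 1) <= _).
    rewrite exp_Ropp; apply: Rinv_le_contravar; [exact: exp_pos|exact: exp_le_3].
  by apply: exp_le_exp; nra.
have p2 : p <= 2.
  apply: Rle_trans (_ : exp (/ 2) <= _); last by apply: Rle_trans (exp_le_1_2x _ _) _; lra.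
  by apply: exp_le_exp; nra.
have ps : 0 <= s * s by nra.
have ps3 : / 3 * (s * s) <= p * (s * s) by apply: Rmult_le_compat_r.
have ps2 : p * (s * s) <= 2 * (s * s) by apply: Rmult_le_compat_r.
have sm : s <= m.
  by apply: le_of_sq_le => //; have := pow2_ge_0 (p - 1); lra.
split.
  case: (Rle_lt_dec (c * s) (tau / 2)) => h; last by nra.
  have : p <= / (1 + tau / 2).
    rewrite -(exp_ln (1 + tau / 2)); last lra.
    rewrite -exp_Ropp /p.
    have l : ln (1 + tau / 2) <= tau / 2.
      rewrite -{2}(ln_exp (tau / 2)); apply: ln_le; first lra.
      exact: exp_ineq1_le.
    by apply: exp_le_exp; lra.
  move=> hp.
  have hp' : p * (1 + tau / 2) <= 1.
    have := Rmult_le_compat_r (1 + tau / 2) _ _ ltac:(lra) hp.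
    by rewrite Rinv_l; lra.
  have h4 : tau / 4 <= 1 - p by nra.
  have : tau / 4 <= m by apply: le_of_sq_le => //; nra.
  lra.
have h1 : - (tau + s) <= p - 1 <= 2 * (tau + s).
  split; first by have := exp_ineq1_le (- tau + c * s); rewrite -/p; nra.
  case: (Rle_lt_dec (- tau + c * s) 0) => h.
    have : p <= 1.
      by rewrite -exp_0; exact: exp_le_exp.
    lra.
  by have := exp_le_1_2x (- tau + c * s) ltac:(nra); rewrite -/p; nra.
apply: le_of_sq_le; first lra.
have : (p - 1) ^ 2 <= (2 * (tau + s)) ^ 2 by nra.
nra.
Qed.

(** * Integral bounds along the curve *)

Lemma sin_ge_quarter x : 0 <= x <= PI / 2 -> x / 4 <= sin x.
Proof.
move=> hx; have P4 := PI_4; have PP := PI_RGT_0.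
have small y : 0 <= y <= 1 -> y / 2 <= sin y.
  move=> hy.
  have [xi [hxi e]] := MVT_gen sin 0 y cos
    ltac:(move=> t _; exact: is_derive_sin)
    ltac:(move=> t _; exact: continuity_sin).
  move: hxi; rewrite Rmin_left ?Rmax_right; try lra; move=> hxi.
  move: e; rewrite sin_0 !Rminus_0_r => ->.
  have [_ h] := one_sub_cos_bound xi.
  have : / 2 <= cos xi by nra.
  nra.
case: (Rle_lt_dec x 1) => h; first by have := small x ltac:(lra); lra.
have s1 := small 1 ltac:(lra).
have : sin 1 <= sin x by apply: sin_incr_1; lra.
lra.
Qed.

Lemma ln_le_sub1 y : 0 < y -> ln y <= y - 1.
Proof. by move=> hy; have := exp_ineq1_le (ln y); rewrite exp_ln //; lra. Qed.

(** Taking logarithms, this follows from [ln z <= z - 1] at [z = (1 + x) c / d]. *)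
Lemma Rpower_exp_bounded b c : 0 < c -> exists2 K, 0 < K &
  forall x, 0 <= x -> Rpower (1 + x) b * exp (- (c * x)) <= K.
Proof.
move=> hc; set d := Rabs b + 1.
have d0 : 0 < d by have := Rabs_pos b; rewrite /d; lra.
exists (exp (c + d * ln (d / c))); first exact: exp_pos.
move=> x hx; rewrite /Rpower -exp_plus; apply: exp_le_exp.
have l0 : 0 <= ln (1 + x) by rewrite -ln_1; apply: ln_le; lra.
have h1 : b * ln (1 + x) <= d * ln (1 + x).
  by apply: Rmult_le_compat_r => //; have := Rle_abs b; rewrite /d; lra.
have q : 0 < d / c by exact: Rdiv_lt_0_compat.
have q' : 0 < (1 + x) / (d / c) by apply: Rdiv_lt_0_compat; lra.
have h2 : ln (1 + x) <= (1 + x) / (d / c) - 1 + ln (d / c).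
  have {1}-> : 1 + x = (1 + x) / (d / c) * (d / c) by field; lra.
  by rewrite ln_mult //; have := ln_le_sub1 _ q'; lra.
have h3 : d * ln (1 + x) <= d * ((1 + x) / (d / c) - 1 + ln (d / c)).
  by apply: Rmult_le_compat_l; lra.
have e : d * ((1 + x) / (d / c) - 1 + ln (d / c)) =
  c * (1 + x) - d + d * ln (d / c) by field; lra.
lra.
Qed.

Lemma Rpower_comparable b z x : 0 < x -> x / 6 <= z <= 6 * x ->
  Rpower z b <= Rpower 6 (Rabs b) * Rpower x b.
Proof.
move=> hx hz; rewrite /Rpower -exp_plus; apply: exp_le_exp.
have l1 : ln z <= ln 6 + ln x by rewrite -ln_mult; try lra; apply: ln_le; lra.
have l2 : ln x - ln 6 <= ln z by rewrite -ln_div; try lra; apply: ln_le; lra.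
case: (Rle_lt_dec 0 b) => hb; first by rewrite Rabs_pos_eq //; nra.
by rewrite Rabs_left //; nra.
Qed.

(** Dominates [(1 + N sin (t/2)) ^ (-2)]: the curve comes close to 1 at both ends
    of the interval, and each summand accounts for one of them. *)
Definition majorant (N t : R) := / (1 + N * t / 8) ^ 2 + / (1 + N * (2 * PI - t) / 8) ^ 2.

Lemma majorant_int N : 0 < N -> exists2 v, is_RInt (majorant N) 0 (2 * PI) v & v <= 16 / N.
Proof.
move=> hN; have P0 := PI_RGT_0.
have pos t : 0 <= t <= 2 * PI -> 0 < 1 + N * t / 8 /\ 0 < 1 + N * (2 * PI - t) / 8.
  by move=> ht; split; have : 0 <= N * t; nra.
exists (minus (- (8 / N) / (1 + N * (2 * PI) / 8) + (8 / N) / (1 + N * (2 * PI - 2 * PI) / 8))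
  (- (8 / N) / (1 + N * 0 / 8) + (8 / N) / (1 + N * (2 * PI - 0) / 8))).
  have := is_RInt_derive (fun t => - (8 / N) / (1 + N * t / 8) +
    (8 / N) / (1 + N * (2 * PI - t) / 8)) (majorant N) 0 (2 * PI).
  apply; rewrite Rmin_0_2PI Rmax_0_2PI => t ht; have [p1 p2] := pos t ht.
    rewrite /majorant; auto_derive; first by rewrite /Rdiv in p1 p2; repeat split; lra.
    field; lra.
  apply: ex_derive_continuous; rewrite /majorant; auto_derive.
  by rewrite /Rdiv in p1 p2; repeat split; nra.
rewrite /minus /plus /opp /=.
have q : 0 < 1 + N * (2 * PI) / 8 by have : 0 < N * PI; nra.
have -> : - (8 / N) / (1 + N * (2 * PI) / 8) + 8 / N / (1 + N * (2 * PI - 2 * PI) / 8) +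
  - (- (8 / N) / (1 + N * 0 / 8) + 8 / N / (1 + N * (2 * PI - 0) / 8)) =
  16 / N - 2 * (8 / N / (1 + N * (2 * PI) / 8)) by field; nra.
have : 0 < 8 / N / (1 + N * (2 * PI) / 8).
  by apply: Rdiv_lt_0_compat => //; apply: Rdiv_lt_0_compat; lra.
lra.
Qed.

Lemma majorant_ge N t : 0 < N -> 0 <= t <= 2 * PI ->
  / (1 + N * sin (t / 2)) ^ 2 <= majorant N t.
Proof.
move=> hN ht; have P0 := PI_RGT_0.
have key x : 0 <= x -> x <= sin (t / 2) ->
    / (1 + N * sin (t / 2)) ^ 2 <= / (1 + N * x) ^ 2.
  move=> hx hxs; apply: Rinv_le_contravar.
    by apply: pow_lt; nra.
  by apply: pow_incr; nra.
have p1 : 0 <= / (1 + N * t / 8) ^ 2.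
  by apply/Rlt_le/Rinv_0_lt_compat/pow_lt; have : 0 <= N * t; nra.
have p2 : 0 <= / (1 + N * (2 * PI - t) / 8) ^ 2.
  by apply/Rlt_le/Rinv_0_lt_compat/pow_lt; have : 0 <= N * (2 * PI - t); nra.
rewrite /majorant; case: (Rle_lt_dec t PI) => h.
  have := key (t / 8) ltac:(lra).
  have e : t / 8 = t / 2 / 4 by field.
  rewrite {1}e => /(_ (sin_ge_quarter (t / 2) ltac:(lra))).
  have -> : N * (t / 8) = N * t / 8 by field.
  lra.
have := key ((2 * PI - t) / 8) ltac:(lra).
have e : (2 * PI - t) / 8 = (PI - t / 2) / 4 by field.
have s : sin (t / 2) = sin (PI - t / 2) by rewrite sin_PI_x.
rewrite {1}e {1}s => /(_ (sin_ge_quarter (PI - t / 2) ltac:(lra))).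
have -> : N * ((2 * PI - t) / 8) = N * (2 * PI - t) / 8 by field.
lra.
Qed.

(** On the curve with [tau = 1/N], the factor [exp (-c N sin (t/2))] coming from
    [w^-N] makes [|1 - w|^b |w|^-N] integrable with total mass [O(N^(-b-1))],
    whatever the sign of [b]. *)
Lemma arc_majorant b c : 0 < c <= / 2 -> exists2 K, 0 < K & forall N t,
  1 <= N -> 0 <= t <= 2 * PI ->
  Rpower (Cmod (1 - Cexp (arc (- / N) c t))) b * exp (- (N * (- / N + c * sin (t / 2))))
   <= K * Rpower N (- b) * majorant N t.
Proof.
move=> hc; have [K K0 hK] := Rpower_exp_bounded (b + 2) c ltac:(lra).
have P6 : 0 < Rpower 6 (Rabs b) by exact: exp_pos.
exists (Rpower 6 (Rabs b) * exp 1 * K).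
  by do 2! apply: Rmult_lt_0_compat => //; exact: exp_pos.
move=> N t hN ht.
have hs := sin_half_bounds t ht.
have tau : 0 < / N <= 1.
  split; first by apply: Rinv_0_lt_compat; lra.
  by rewrite -Rinv_1; apply: Rinv_le_contravar; lra.
have D := arc_dist (/ N) c t tau hc ht.
have M := majorant_ge N t ltac:(lra) ht.
move: D M; set s := sin (t / 2) in hs *; set z := Cmod _; set m := majorant N t => D M.
have A1 := Rpower_comparable b z (/ N + s) ltac:(lra) D.
have y1 : 1 <= 1 + N * s by nra.
have e1 : Rpower (/ N + s) b = Rpower N (- b) * Rpower (1 + N * s) b.
  have -> : / N + s = (1 + N * s) * / N by field; lra.
  rewrite -Rpower_mult_distr; try lra.
  by rewrite Rmult_comm /Rpower ln_Rinv; [congr (exp _ * _); ring|lra].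
have e2 : exp (- (N * (- / N + c * s))) = exp 1 * exp (- (c * (N * s))).
  by rewrite -exp_plus; congr exp; field; lra.
have e3 : Rpower (1 + N * s) b = Rpower (1 + N * s) (b + 2) * / (1 + N * s) ^ 2.
  have -> : (1 + N * s) ^ 2 = Rpower (1 + N * s) 2.
    by rewrite -Rpower_pow; [congr Rpower|lra].
  by rewrite -Rpower_Ropp -Rpower_plus; congr Rpower; ring.
have B := hK (N * s) ltac:(nra).
rewrite e2; apply: Rle_trans (Rmult_le_compat_r _ _ _ _ A1) _.
  by apply: Rmult_le_pos; apply/Rlt_le/exp_pos.
rewrite e1 e3.
have pn : 0 < Rpower N (- b) by exact: exp_pos.
have pm : 0 < / (1 + N * s) ^ 2 by apply/Rinv_0_lt_compat/pow_lt; lra.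
have -> : Rpower 6 (Rabs b) * (Rpower N (- b) * (Rpower (1 + N * s) (b + 2) * / (1 + N * s) ^ 2)) *
  (exp 1 * exp (- (c * (N * s)))) =
  Rpower 6 (Rabs b) * exp 1 * Rpower N (- b) *
   ((Rpower (1 + N * s) (b + 2) * exp (- (c * (N * s)))) * / (1 + N * s) ^ 2) by ring.
have -> : Rpower 6 (Rabs b) * exp 1 * K * Rpower N (- b) * m =
  Rpower 6 (Rabs b) * exp 1 * Rpower N (- b) * (K * m) by ring.
apply: Rmult_le_compat_l.
  by do ! apply: Rmult_le_pos => //; try lra; apply/Rlt_le/exp_pos.
by apply: Rmult_le_compat => //; [apply: Rmult_le_pos; apply/Rlt_le/exp_pos|lra].
Qed.

Lemma Cmod_kern a c n t : 0 <= c <= 2 ->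
  Cmod (kern a c n t) <= 2 * exp (- (INR n * (a + c * sin (t / 2)))).
Proof.
move=> hc; rewrite /kern Cmod_mult Cmod_Cexp Rmult_comm.
have -> : Re (- RtoC (INR n) * arc a c t) = - (INR n * (a + c * sin (t / 2))).
  by rewrite /arc /Re /=; ring.
apply: Rmult_le_compat_r; first exact/Rlt_le/exp_pos.
apply: Rle_trans (Cmod_le_Re_Im _) _; rewrite /darc /Re /Im /= Rabs_R1.
have b := COS_bound (t / 2).
have : Rabs (c / 2 * cos (t / 2)) <= 1 by apply: Rabs_le; nra.
lra.
Qed.

Lemma has_coef_bound a c n G l g v : has_coef a c n G l ->
  (forall t, 0 <= t <= 2 * PI -> Cmod (G (Cexp (arc a c t)) * kern a c n t) <= g t) ->
  is_RInt g 0 (2 * PI) v -> 2 * PI * Cmod l <= v.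
Proof.
move=> hG hg hv; have P0 := PI_RGT_0.
have v0 : 0 <= v.
  apply: is_RInt_ge_0 hv _; first lra.
  by move=> t ht; apply: Rle_trans (Cmod_ge_0 _) (hg t _); lra.
case: (Req_dec (Cmod l) 0) => [->|l0]; first lra.
have l1 : 0 < Cmod l by have := Cmod_ge_0 l; lra.
(* This choice turns the real part of [2 PI i mu l] into [2 PI |l|^2]. *)
set mu := Cconj (Ci * l).
have mm : Cmod mu = Cmod l by rewrite Cmod_conj Cmod_mult Cmod_Ci Rmult_1_l.
have e : Re (RtoC (2 * PI) * Ci * (mu * l)) = 2 * PI * (Cmod l * Cmod l).
  by rewrite Cmod2_ReIm /mu /Re /Im /=; ring.
have := hG mu; rewrite e => H.
have := is_RInt_le _ _ 0 (2 * PI) _ _ ltac:(lra) H (is_RInt_scal _ _ _ (Cmod l) _ hv).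
have h : forall t, 0 < t < 2 * PI ->
   Re (mu * G (Cexp (arc a c t)) * kern a c n t) <= scal (Cmod l) (g t).
  move=> t ht; apply: Rle_trans (Rle_abs _) _; apply: Rle_trans (re_le_Cmod _) _.
  rewrite -Cmult_assoc Cmod_mult mm; apply: Rmult_le_compat_l; first lra.
  by apply: hg; lra.
move=> /(_ h); rewrite /scal /= /mult /= => k.
apply: (Rmult_le_reg_l (Cmod l)) => //; lra.
Qed.

Lemma has_coef_plus a c n f g k l : has_coef a c n f k -> has_coef a c n g l ->
  has_coef a c n (fun w => f w + g w)%C (k + l)%C.
Proof.
move=> hf hg mu.
have -> : Re (RtoC (2 * PI) * Ci * (mu * (k + l))) =
  plus (Re (RtoC (2 * PI) * Ci * (mu * k))) (Re (RtoC (2 * PI) * Ci * (mu * l))).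
  by rewrite -[plus _ _]/(Re (_ + _)%C); congr Re; ring.
apply: is_RInt_ext (is_RInt_plus _ _ _ _ _ _ (hf mu) (hg mu)) => t _.
by rewrite -[plus _ _]/(Re (_ + _)%C); congr Re; ring.
Qed.

Lemma has_coef_scal a c n f l k : has_coef a c n f l ->
  has_coef a c n (fun w => k * f w)%C (k * l)%C.
Proof.
move=> hf mu.
have -> : (mu * (k * l) = mu * k * l)%C by ring.
apply: is_RInt_ext (hf (mu * k)%C) => t _; congr Re; ring.
Qed.

(** * Uniform transfer from the singularity to the coefficients *)

Lemma Arg_gt phi z : 0 < phi < PI / 2 -> Re z < cos phi * Cmod z -> phi < Rabs (Arg z).
Proof.
move=> hphi hz; have P0 := PI_RGT_0; have m0 := Cmod_ge_0 z.
have /Rabs_le_between r := re_le_Cmod z.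
have m1 : 0 < Cmod z.
  case: m0 => // e; rewrite -e in hz r; lra.
set q := Re z / Cmod z.
have q1 : -1 <= q <= 1.
  by split; [apply/Rcomplements.Rle_div_r|apply/Rcomplements.Rle_div_l]; lra.
have q2 : q < cos phi by apply/Rcomplements.Rlt_div_l.
have B := acos_bound q.
have -> : Rabs (Arg z) = acos q.
  rewrite /Arg; case: Req_dec_T => h /=; first lra.
  by case: Rle_dec => hi /=; rewrite -/q ?Rabs_Ropp Rabs_pos_eq //; lra.
apply: cos_decreasing_0; try lra.
by rewrite cos_acos.
Qed.

Lemma slit_domain_slit_disc delta phi rho w : 0 < rho -> 0 < phi < PI / 2 ->
  slit_domain delta (cos phi) w -> slit_disc delta phi rho (RtoC rho * w)%C.
Proof.
move=> hr hphi [h1 h2]; have r0 : RtoC rho <> 0 by move=> []; lra.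
split.
  rewrite /closed_disc Cmod_mult Cmod_R Rabs_pos_eq; last lra.
  rewrite /open_disc in h1; nra.
have -> : (RtoC rho * w / RtoC rho - 1 = w - 1)%C by field.
exact: Arg_gt.
Qed.

Lemma open_disc_closed_disc delta rho w : 0 < rho -> open_disc delta w ->
  closed_disc delta rho (RtoC rho * w)%C.
Proof.
rewrite /open_disc /closed_disc => hr hw.
rewrite Cmod_mult Cmod_R Rabs_pos_eq; last lra.
nra.
Qed.

Lemma analytic_at_scal_sdiff F rho w : analytic_at F (RtoC rho * w)%C ->
  exists a, sdiff (fun v => F (RtoC rho * v)%C) w a.
Proof.
move=> /analytic_at_sdiff [a ha]; eexists.
exact: sdiff_comp (sdiff_scal _ _) ha.
Qed.

Lemma is_pseries_scal_arg (b : nat -> C) (rho : R) (x l : C) :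
  @is_pseries C_AbsRing C_NormedModule b (RtoC rho * x)%C l ->
  @is_pseries C_AbsRing C_NormedModule (fun k => b k * RtoC (rho ^ k))%C x l.
Proof.
apply: is_series_ext => k; rewrite !pow_nC.
rewrite /scal /= /mult /=.
have -> : ((RtoC rho * x) ^ k = RtoC (rho ^ k) * x ^ k)%C.
  by elim: k => [|k IH] /=; [rewrite Cmult_1_l|rewrite IH RtoC_mult; ring].
ring.
Qed.

Lemma has_coef_continues D delta0 a c n rho (b : nat -> C) F : 0 < rho -> copen D ->
  (forall w, D w -> exists d, sdiff (fun v => F (RtoC rho * v)%C) w d) ->
  curve_in D a c -> 0 < delta0 ->
  (forall x, Cmod x < delta0 -> @is_pseries C_AbsRing C_NormedModule b x (F x)) ->
  has_coef a c n (fun v => F (RtoC rho * v)%C) (b n * RtoC (rho ^ n))%C.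
Proof.
move=> hr oD hF cD d0 hb.
have q : 0 < delta0 / rho by exact: Rdiv_lt_0_compat.
apply: (has_coef_pseries D a c n _ (fun k => b k * RtoC (rho ^ k))%C (mkposreal _ q)) => //.
move=> x /= hx; apply/is_pseries_scal_arg/hb.
rewrite Cmod_mult Cmod_R Rabs_pos_eq; last lra.
have := Rmult_lt_compat_l _ _ _ hr hx.
by have -> : rho * (delta0 / rho) = delta0 by field; lra.
Qed.

(** At distance [t >= d] the bound [M] of [omega] is at most [(M / d) t]. *)
Lemma error_modulus_affine omega : error_modulus omega -> forall e, 0 < e ->
  exists2 K, 0 <= K & forall t, 0 < t -> omega t <= e + K * t.
Proof.
case=> w0 [[M hM] wl] e he.
have [d hd] := wl _ (locally_ball 0 (mkposreal _ he)).
have d0 := cond_pos d.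
have M0 : 0 <= M by apply: Rle_trans (w0 1 Rlt_0_1) (hM 1 Rlt_0_1).
exists (M / d); first exact: Rdiv_le_0_compat.
move=> t ht; case: (Rlt_le_dec t d) => h.
  have : ball 0 (mkposreal _ he) (omega t).
    apply: hd => //; rewrite /ball /= /AbsRing_ball /abs /minus /plus /opp /=.
    by rewrite Ropp_0 Rplus_0_r Rabs_pos_eq; lra.
  rewrite /ball /= /AbsRing_ball /abs /minus /plus /opp /= Ropp_0 Rplus_0_r => k.
  have := Rle_abs (omega t).
  have : 0 <= M / d * t by apply: Rmult_le_pos; [exact: Rdiv_le_0_compat|lra].
  lra.
have : M / d * d <= M / d * t by apply: Rmult_le_compat_l => //; exact: Rdiv_le_0_compat.
have -> : M / d * d = M by field; lra.
have := hM t ht; lra.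
Qed.

Lemma Rpower_pred N b : 0 < N -> Rpower N (b - 1) = Rpower N b / N.
Proof.
by move=> hN; rewrite /Rminus Rpower_plus Rpower_Ropp Rpower_1.
Qed.

Lemma exp_decay b c : 0 < c -> exists2 K, 0 < K &
  forall N, 1 <= N -> exp (- (N * c)) <= K * Rpower N b.
Proof.
move=> hc; have [K K0 hK] := Rpower_exp_bounded (- b) c hc.
have P6 : 0 < Rpower 6 (Rabs (- b)) by exact: exp_pos.
exists (Rpower 6 (Rabs (- b)) * K); first exact: Rmult_lt_0_compat.
move=> N hN.
have h1 := Rpower_comparable (- b) N (1 + N) ltac:(lra) ltac:(lra).
have h2 := hK N ltac:(lra).
have pb : 0 < Rpower N b by exact: exp_pos.
have e0 := exp_pos (- (c * N)).
have e : Rpower N (- b) * Rpower N b = 1.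
  by rewrite -Rpower_plus Rplus_opp_l Rpower_O //; lra.
have -> : N * c = c * N by ring.
have h3 : Rpower N (- b) * exp (- (c * N)) <= Rpower 6 (Rabs (- b)) * K.
  apply: Rle_trans (Rmult_le_compat_r _ _ _ (Rlt_le _ _ e0) h1) _.
  by rewrite Rmult_assoc; apply: Rmult_le_compat_l; lra.
have := Rmult_le_compat_r _ _ _ (Rlt_le _ _ pb) h3.
have -> : Rpower N (- b) * exp (- (c * N)) * Rpower N b =
  (Rpower N (- b) * Rpower N b) * exp (- (c * N)) by ring.
rewrite e; lra.
Qed.

(** The regular part [U] contributes exponentially small coefficients (circle
    of radius [exp c > 1]); the error is integrated along the curve through
    [exp (- 1 / n)]. There [omega t <= e + K t], so the bounds for the exponents
    [alpha] and [alpha + 1] suffice. *)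
Lemma transfer delta phi alpha M omega : 0 < delta -> 0 < phi < PI / 2 ->
  error_modulus omega -> forall eps, 0 < eps -> exists N : nat,
  forall (f : nat -> R) F U A rho, 0 < rho -> continues f F ->
  analytic_on (slit_disc delta phi rho) F ->
  analytic_on (closed_disc delta rho) U ->
  (forall x, closed_disc delta rho x -> Cmod (U x) <= M) ->
  expansion (slit_disc delta phi rho) F U A alpha rho omega ->
  forall n, (N <= n)%N ->
  Cmod (RtoC (f n * rho ^ n) - A * RtoC (bin_coef alpha n)) <=
    eps * Rpower (INR n) (- alpha - 1).
Proof.
move=> hd hphi hom eps heps; have P0 := PI_RGT_0.
have P1 : 1 <= 2 * PI by have := PI2_3_2; lra.
set k := cos phi.
have hk : 0 < k < 1.
  split; first by apply: cos_gt_0; lra.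
  by rewrite /k -cos_0; apply: cos_decreasing_1; lra.
have ld : 0 < ln (1 + delta) by rewrite -ln_1; apply: ln_increasing; lra.
(* Slope of the curve: it has to stay out of the sector and in the disc. *)
set c := Rmin k (Rmin (/ 2) (ln (1 + delta) / 2)).
have c0 : 0 < c by do ! apply: Rmin_glb_lt; lra.
have ck : c <= k by exact: Rmin_l.
have c2 : c <= / 2 by apply: Rle_trans (Rmin_r _ _) (Rmin_l _ _).
have cl : c <= ln (1 + delta) / 2 by apply: Rle_trans (Rmin_r _ _) (Rmin_r _ _).
have ec : exp c < 1 + delta.
  by rewrite -(exp_ln (1 + delta)); [apply: exp_increasing|]; lra.
have [K1 K10 hK1] := arc_majorant alpha c ltac:(lra).
have [K2 K20 hK2] := arc_majorant (alpha + 1) c ltac:(lra).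
have [K3 K30 hK3] := exp_decay (- alpha - 1 - 1) c c0.
have e0 : 0 < eps / (64 * K1) by apply: Rdiv_lt_0_compat; lra.
have [Ko Ko0 hKo] := error_modulus_affine omega hom _ e0.
set e := eps / (64 * K1) in e0 hKo.
set M' := Rabs M.
have M0 : 0 <= M' by exact: Rabs_pos.
set C := 32 * (Ko * K2) + 2 * M' * K3.
have C0 : 0 <= C.
  by have := Rmult_le_pos _ _ Ko0 (Rlt_le _ _ K20);
     have := Rmult_le_pos _ _ M0 (Rlt_le _ _ K30); rewrite /C; lra.
have [N hN] := INR_unbounded (2 * C / eps + 1).
exists N => f F U A rho hr [r hF] aF aU bU ex n hn.
have n1 : 2 * C / eps + 1 <= INR n.
  by apply: Rlt_le (Rlt_le_trans _ _ _ hN _); apply: le_INR; apply/leP.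
have C1 : 0 <= 2 * C / eps by apply: Rdiv_le_0_compat; lra.
set x := INR n in n1 *.
have x1 : 1 <= x by lra.
have Cx : C / x <= eps / 2.
  apply/Rcomplements.Rle_div_l; first lra.
  have : 2 * C / eps * eps <= x * eps by apply: Rmult_le_compat_r; lra.
  have -> : 2 * C / eps * eps = 2 * C by field; lra.
  lra.
set Q := Rpower x (- alpha - 1).
have Q0 : 0 < Q by exact: exp_pos.
have xi : 0 < / x by apply: Rinv_0_lt_compat; lra.
have ha : - / x < 0 by lra.
have oD := copen_slit_domain delta k hk.
have cD := curve_in_slit_domain delta k (- / x) c hd hk ha c0 ck c2 (Rlt_le _ _ ec).
have oB := copen_open_disc delta.
have cB : curve_in (open_disc delta) (- / x) c.
  by apply: curve_in_mono cD => w [].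
have cB' := curve_in_open_disc delta c c0 ec.
have dF w : slit_domain delta k w -> exists d, sdiff (fun v => F (RtoC rho * v)%C) w d.
  by move=> hw; apply/analytic_at_scal_sdiff/aF/slit_domain_slit_disc.
have dU w : open_disc delta w -> exists d, sdiff (fun v => U (RtoC rho * v)%C) w d.
  by move=> hw; apply/analytic_at_scal_sdiff/aU/open_disc_closed_disc.
have U0 : closed_disc delta rho 0.
  by rewrite /closed_disc Cmod_0 Rabs_pos_eq; nra.
have [u [ru hu]] := aU _ U0.
have hu' y : Cmod y < ru -> @is_pseries C_AbsRing C_NormedModule u y (U y).
  have {2 3}-> : y = (y - 0)%C by ring.
  by move=> hy; have := hu y; rewrite (_ : (y - 0 = y)%C); [apply|ring].
have HF := has_coef_continues _ _ (- / x) c n rho _ F hr oD dF cD (cond_pos r) hF.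
have HU := has_coef_continues _ _ (- / x) c n rho u U hr oB dU cB (cond_pos ru) hu'.
have HU' := has_coef_continues _ _ c 0 n rho u U hr oB dU cB' (cond_pos ru) hu'.
have HP := has_coef_pow1m _ (- / x) c n alpha oD cD (fun w => slit_domain_slit_plane delta k w hk).
have HG := has_coef_plus _ _ _ _ _ _ _ HF
  (has_coef_scal _ _ _ _ _ (- RtoC 1)%C (has_coef_plus _ _ _ _ _ _ _ HU
    (has_coef_scal _ _ _ _ _ A HP))).
set l := (_ + _)%C in HG.
(* Coefficient of the regular part, from the circle of radius [exp c]. *)
have Bu : Cmod (u n * RtoC (rho ^ n)) <= 2 * M' * K3 * (Q / x).
  have h := has_coef_bound _ _ _ _ _ (fun _ => M' * (2 * exp (- (x * c)))) _ HU' _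
    (is_RInt_const 0 (2 * PI) _).
  have {h} : 2 * PI * Cmod (u n * RtoC (rho ^ n)) <=
     (2 * PI - 0) * (M' * (2 * exp (- (x * c)))).
    apply: h => t ht; rewrite Cmod_mult; apply: Rmult_le_compat; try exact: Cmod_ge_0.
      apply: Rle_trans (Rle_abs M); apply/bU/open_disc_closed_disc => //.
      rewrite /open_disc Cmod_Cexp.
      by have -> : Re (arc c 0 t) = c by rewrite /arc /Re /=; ring.
    have := Cmod_kern c 0 n t ltac:(lra).
    by rewrite -/x (_ : c + 0 * sin (t / 2) = c); [|ring].
  rewrite Rminus_0_r => h.
  have {}h : Cmod (u n * RtoC (rho ^ n)) <= M' * (2 * exp (- (x * c))).
    by apply: (Rmult_le_reg_l (2 * PI)) => //; lra.
  have := hK3 x x1; rewrite Rpower_pred; last lra.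
  rewrite -/Q => h3; apply: Rle_trans h _.
  have := Rmult_le_compat_l _ _ _ M0 h3; lra.
(* Coefficient of the error term, from the curve through [exp (- 1 / n)]. *)
have Bl : Cmod l <= 32 * (e * K1 * Q + Ko * K2 * (Q / x)).
  have [v hv vb] := majorant_int x ltac:(lra).
  have h := has_coef_bound _ _ _ _ _ _ _ HG _ (is_RInt_scal _ _ _
    (2 * (e * K1 * Rpower x (- alpha) + Ko * K2 * Rpower x (- (alpha + 1)))) _ hv).
  have pa : 0 < Rpower x (- alpha) by exact: exp_pos.
  have pa' : 0 < Rpower x (- (alpha + 1)) by exact: exp_pos.
  have pe : 0 <= e * K1 by apply: Rmult_le_pos; lra.
  have pK : 0 <= Ko * K2 by apply: Rmult_le_pos; lra.
  have W0 : 0 <= 2 * (e * K1 * Rpower x (- alpha) + Ko * K2 * Rpower x (- (alpha + 1))).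
    by have := Rmult_le_pos _ _ pe (Rlt_le _ _ pa);
       have := Rmult_le_pos _ _ pK (Rlt_le _ _ pa'); lra.
  have {}h : 2 * PI * Cmod l <=
    2 * (e * K1 * Rpower x (- alpha) + Ko * K2 * Rpower x (- (alpha + 1))) * v.
    apply: h => t ht; rewrite /scal /= /mult /=.
    set w := Cexp _.
    have Dw : slit_domain delta k w.
      by case: cD => eta eta0 /(_ 1 t ltac:(lra) ht); rewrite Cmult_1_l.
    have w0 := slit_plane_neq0 _ (slit_domain_slit_plane _ _ _ hk Dw).
    have r0 : RtoC rho <> 0 by move=> []; lra.
    have := ex _ (slit_domain_slit_disc _ _ _ _ hr hphi Dw).
    have -> : (1 - RtoC rho * w / RtoC rho = 1 - w)%C by field.
    set z := Cmod (1 - w).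
    have z0 : 0 < z by apply/Cmod_gt_0.
    rewrite /= -/z => E.
    have -> : (F (RtoC rho * w) + - RtoC 1 * (U (RtoC rho * w) + A * pow1m alpha w) =
      F (RtoC rho * w) - (U (RtoC rho * w) + A * Cpower (1 - w) alpha))%C.
      by rewrite /pow1m; ring.
    rewrite Cmod_mult.
    have zp : 0 < Rpower z alpha by exact: exp_pos.
    have E' : Cmod (F (RtoC rho * w)%C - (U (RtoC rho * w)%C + A * Cpower (1 - w) alpha))
       <= e * Rpower z alpha + Ko * Rpower z (alpha + 1).
      apply: Rle_trans E _; rewrite Rpower_plus Rpower_1 //.
      have := Rmult_le_compat_r _ _ _ (Rlt_le _ _ zp) (hKo z z0); lra.
    apply: Rle_trans (Rmult_le_compat _ _ _ _ (Cmod_ge_0 _) (Cmod_ge_0 _) E'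
      (Cmod_kern _ c n t ltac:(lra))) _.
    have m1 := hK1 x t x1 ht; have m2 := hK2 x t x1 ht.
    rewrite -/w -/z in m1 m2; rewrite -/x.
    set X := exp _ in m1 m2 *.
    have := Rmult_le_compat_l _ _ _ (Rlt_le _ _ e0) m1.
    have := Rmult_le_compat_l _ _ _ Ko0 m2.
    lra.
  have s1 : Rpower x (- alpha) = Q * x.
    by rewrite /Q Rpower_pred; [field|]; lra.
  have s2 : Rpower x (- (alpha + 1)) = Q by congr Rpower; ring.
  rewrite s1 s2 in h W0.
  have h2 := Rmult_le_compat_l _ _ _ W0 vb.
  have h3 : 1 * Cmod l <= 2 * PI * Cmod l.
    by apply: Rmult_le_compat_r => //; exact: Cmod_ge_0.
  have -> : 32 * (e * K1 * Q + Ko * K2 * (Q / x)) =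
    2 * (e * K1 * (Q * x) + Ko * K2 * Q) * (16 / x) by field; lra.
  lra.
have -> : (RtoC (f n * rho ^ n) - A * RtoC (bin_coef alpha n) = l + u n * RtoC (rho ^ n))%C.
  by rewrite /l RtoC_mult; ring.
apply: Rle_trans (Cmod_triangle _ _) _.
have eK : e * K1 = eps / 64 by rewrite /e; field; lra.
rewrite eK in Bl.
have f1 : 32 * (Ko * K2) * (Q / x) + 2 * M' * K3 * (Q / x) = C / x * Q.
  by rewrite /C; field; lra.
have f2 : C / x * Q <= eps / 2 * Q by apply: Rmult_le_compat_r; lra.
lra.
Qed.

(** * Lower bound for the binomial coefficients *)

(** As [exp v >= 1 + v], it suffices that [(1 - x) (1 + x + 2 x^2) >= 1], and this product
    is [1 + x^2 (1 - 2 x)]. *)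
Lemma ln_1_sub_ge x : x <= / 2 -> - x - 2 * x ^ 2 <= ln (1 - x).
Proof.
move=> hx; have p : 0 < 1 + (x + 2 * x ^ 2) by nra.
rewrite -(ln_exp (- x - 2 * x ^ 2)); apply: ln_le; first exact: exp_pos.
have -> : - x - 2 * x ^ 2 = - (x + 2 * x ^ 2) by ring.
rewrite exp_Ropp.
apply: Rle_trans (Rinv_le_contravar _ _ p (exp_ineq1_le _)) _.
apply: (Rmult_le_reg_l _ _ _ p); rewrite Rinv_r; last lra.
have : 0 <= x ^ 2 * (1 - 2 * x) by apply: Rmult_le_pos; [exact: pow2_ge_0|lra].
lra.
Qed.

Lemma bin_coef_neq0 al n : (forall k : nat, al <> INR k) -> bin_coef al n <> 0.
Proof.
move=> h; elim: n => [|n IH]; first by rewrite /=; lra.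
rewrite -[bin_coef al n.+1]/(bin_coef al n * (INR n - al) / INR n.+1).
apply: Rmult_integral_contrapositive_currified.
  apply: Rmult_integral_contrapositive_currified => // e; apply: (h n); lra.
by apply: Rinv_neq_0_compat; apply: not_0_INR.
Qed.

(** [ln |bin_coef n| + (al+1) ln n - L/n] is eventually nondecreasing: the first two
    terms change by [O(1/n^2)], which the last one compensates. *)
Lemma bin_coef_lower al : (forall k : nat, al <> INR k) -> exists C N, 0 < C /\
  forall n, (N <= n)%N -> C * Rpower (INR n) (- al - 1) <= Rabs (bin_coef al n).
Proof.
move=> hal; set a := al + 1; set L := 2 * Rabs a + 2 * a ^ 2.
have a0 := Rabs_pos a.
have L0 : 0 <= L by rewrite /L; have := pow2_ge_0 a; lra.
have [N hN] := INR_unbounded (2 * Rabs a + 2).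
pose v n := ln (Rabs (bin_coef al n)) + a * ln (INR n) - L / INR n.
have pb n : 0 < Rabs (bin_coef al n) by apply/Rabs_pos_lt/bin_coef_neq0.
have step n : (N <= n)%N -> v n <= v n.+1.
  move=> hn.
  have xn : 2 * Rabs a + 2 <= INR n.
    by apply: Rlt_le (Rlt_le_trans _ _ _ hN _); apply: le_INR; apply/leP.
  rewrite /v; set x := INR n in xn *.
  have -> : INR n.+1 = x + 1 by rewrite S_INR.
  set m := x + 1.
  have mi : 0 < / m by apply: Rinv_0_lt_compat; rewrite /m; lra.
  have am : Rabs (a / m) <= / 2.
    rewrite Rabs_div ?(Rabs_pos_eq m); rewrite /m; try lra.
    by apply/Rcomplements.Rle_div_l; lra.
  have m2 : / m <= / 2 by apply: Rinv_le_contravar; rewrite /m; lra.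
  have e1 : Rabs (bin_coef al n.+1) = Rabs (bin_coef al n) * (1 - a / m).
    rewrite -[bin_coef al n.+1]/(bin_coef al n * (INR n - al) / INR n.+1).
    rewrite S_INR -/x -/m.
    have -> : bin_coef al n * (x - al) / m = bin_coef al n * (1 - a / m).
      by rewrite /a /m; field; lra.
    rewrite Rabs_mult (Rabs_pos_eq (1 - a / m)) //.
    by have := Rle_abs (a / m); lra.
  have am' := Rle_abs (a / m).
  rewrite e1 ln_mult //; last lra.
  have e2 : ln x = ln m + ln (1 - / m).
    rewrite -ln_mult; [congr ln|rewrite /m; lra|lra].
    by rewrite /m; field; rewrite /m; lra.
  rewrite e2.
  have l1 := ln_1_sub_ge (a / m) ltac:(lra).
  have l2 := ln_1_sub_ge (/ m) m2.
  have l3 : ln (1 - / m) <= - / m by have := ln_le_sub1 (1 - / m) ltac:(lra); lra.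
  have key : - L * (/ m) ^ 2 <= ln (1 - a / m) - a * ln (1 - / m).
    have i2 := pow2_ge_0 (/ m).
    have sq : (a / m) ^ 2 = a ^ 2 * (/ m) ^ 2 by rewrite /Rdiv Rpow_mult_distr.
    rewrite sq in l1; rewrite /L.
    case: (Rle_lt_dec 0 a) => ha.
      have := Rmult_le_compat_l _ _ _ ha l3.
      have := Rmult_le_pos _ _ a0 i2; rewrite /Rdiv in l1 *; lra.
    rewrite Rabs_left //.
    have := Rmult_le_compat_l (- a) _ _ ltac:(lra) l2; rewrite /Rdiv in l1 *; lra.
  have q : L / x - L / m >= L * (/ m) ^ 2.
    have -> : L / x - L / m = L * (/ (x * m)) by rewrite /m; field; lra.
    apply/Rle_ge/Rmult_le_compat_l => //; rewrite pow_inv.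
    by apply: Rinv_le_contravar; rewrite /m; nra.
  lra.
exists (exp (v N)), N; split; first exact: exp_pos.
move=> n hn.
have mono : v N <= v n.
  rewrite -(subnK hn); elim: (n - N)%N => [|j IH]; first by rewrite add0n; lra.
  by apply: Rle_trans IH _; rewrite addSn; apply: step; rewrite leq_addl.
have xn : 2 * Rabs a + 2 <= INR n.
  by apply: Rlt_le (Rlt_le_trans _ _ _ hN _); apply: le_INR; apply/leP.
rewrite -(exp_ln (Rabs (bin_coef al n))) // /Rpower -exp_plus; apply: exp_le_exp.
have : 0 <= L / INR n by apply: Rdiv_le_0_compat; lra.
rewrite {2}/v in mono.
have -> : (- al - 1) * ln (INR n) = - (a * ln (INR n)) by rewrite /a; ring.
lra.
Qed.

(** * The distribution function at the double-exponential scale *)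

(** Letting [h] tend to infinity in the uniform estimate gives the estimate for
    the limit coefficients [yl n], with the same exponent and the constant [A]. *)
Lemma coef_ratio (y : nat -> nat -> R) (yl b : nat -> R) (rhoh : nat -> R) (rho : R)
    (Ah : nat -> C) (A : C) :
  (forall n, is_lim_seq (fun h => y h n) (yl n)) -> (forall n, b n <> 0) ->
  0 < rho -> is_lim_seq rhoh rho ->
  filterlim Ah eventually (locally A) -> A <> RtoC 0 ->
  (forall eps, 0 < eps -> exists N H, forall h n, (H <= h)%N -> (N <= n)%N ->
     Cmod (RtoC (y h n * rhoh h ^ n / b n) - Ah h) <= eps) ->
  forall eps, 0 < eps -> exists N H, forall n, (N <= n)%N -> yl n <> 0 /\
    forall h, (H <= h)%N -> Rabs (y h n / yl n * (rhoh h / rho) ^ n - 1) <= eps.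
Proof.
move=> hy b0 hr hrho hA A0 hu eps he.
have a0 : 0 < Cmod A by apply/Cmod_gt_0.
set a := Cmod A in a0.
(* The normalised coefficients [q h n] and [Q n] will be within [5 e] of each
   other, while [|Q n| >= a - 3 e]. *)
set e := Rmin (a / 6) (eps * a / 10).
have ea : 0 < eps * a by exact: Rmult_lt_0_compat.
have e0 : 0 < e by apply: Rmin_glb_lt; lra.
have e1 : e <= a / 6 by exact: Rmin_l.
have e2 : e <= eps * a / 10 by exact: Rmin_r.
have [N [H hN]] := hu e e0.
have [H' hH'] : exists H', forall h, (H' <= h)%N -> Cmod (Ah h - A) <= e.
  have /filterlim_locally_ball_norm := (hA : filterlim (U := C_NormedModule) Ah eventually (locally A)).
  move=> /(_ (mkposreal _ e0)) [H' h']; exists H' => h /leP hh.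
  exact: Rlt_le (h' h hh).
pose q h n := y h n * rhoh h ^ n / b n.
pose Q n := yl n * rho ^ n / b n.
have hq h n : (maxn H H' <= h)%N -> (N <= n)%N -> Cmod (RtoC (q h n) - A) <= 2 * e.
  rewrite geq_max => /andP [h1 h2] h3.
  have := hN h n h1 h3; have := hH' h h2; rewrite -/(q h n).
  have := Cmod_triangle3 (RtoC (q h n)) (Ah h) A; lra.
have lim n : is_lim_seq (fun h => q h n) (Q n).
  apply: (is_lim_seq_scal_r (fun h => y h n * rhoh h ^ n) (/ b n) (Finite (yl n * rho ^ n))).
  apply: is_lim_seq_mult' (hy n) _.
  apply: (is_lim_seq_continuous (fun x => x ^ n)); last exact: hrho.
  by apply: derivable_continuous_pt; exact: derivable_pt_pow.
have hQ n : (N <= n)%N -> Cmod (RtoC (Q n) - A) <= 3 * e.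
  move=> hn; have /is_lim_seq_spec /(_ (mkposreal _ e0)) [K hK] := lim n.
  set h := maxn K (maxn H H').
  have := hK h ltac:(apply/leP; exact: leq_maxl) => /= k.
  have := hq h n (leq_maxr _ _) hn.
  have := Cmod_triangle3 (RtoC (Q n)) (RtoC (q h n)) A.
  by rewrite -RtoC_minus Cmod_R Rabs_minus_sym; lra.
exists N, (maxn H H') => n hn.
have Qa : a / 2 <= Rabs (Q n).
  have := hQ n hn; have := Cmod_lower A (RtoC (Q n)).
  rewrite (Cmod_sub_sym A) Cmod_R -/a; lra.
have Q0 : Q n <> 0 by move=> E; move: Qa; rewrite E Rabs_R0; lra.
have rn : rho ^ n <> 0 by apply: pow_nonzero; lra.
have yl0 : yl n <> 0.
  by move=> E; apply: Q0; rewrite /Q E /Rdiv !Rmult_0_l.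
split=> // h hh.
have -> : y h n / yl n * (rhoh h / rho) ^ n - 1 = (q h n - Q n) / Q n.
  rewrite /q /Q /Rdiv Rpow_mult_distr pow_inv; field; split=> //; split=> //.
rewrite Rabs_div //; apply/Rcomplements.Rle_div_l; first lra.
have : Rabs (q h n - Q n) <= 5 * e.
  rewrite -Cmod_R RtoC_minus.
  have := Cmod_triangle3 (RtoC (q h n)) A (RtoC (Q n)).
  rewrite (Cmod_sub_sym A (RtoC (Q n))); have := hQ n hn; have := hq h n hh hn; lra.
nra.
Qed.

Section Scale.
Variables (zeta r : R).
Hypotheses (zeta_bnd : 0 < zeta < 1) (r_gt1 : 1 < r).
Let m n := Rlog r (Rlog (/ zeta) (INR n)).

Lemma ln_r_gt0 : 0 < ln r.
Proof. by rewrite -ln_1; apply: ln_increasing; lra. Qed.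

Lemma ln_d_gt0 : 0 < ln (/ zeta).
Proof.
rewrite -ln_1; apply: ln_increasing; first lra.
by rewrite -Rinv_1; apply: Rinv_lt_contravar; lra.
Qed.

Lemma ln_INR_unbounded B : exists N, forall n, (N <= n)%N -> B < ln (INR n).
Proof.
have [N hN] := INR_unbounded (exp B); exists N => n /leP /le_INR hn.
rewrite -(ln_exp B); apply: ln_increasing; first exact: exp_pos; lra.
Qed.

Lemma Rpower_r_m n : 0 < ln (INR n) -> Rpower r (m n) = ln (INR n) / ln (/ zeta).
Proof.
move=> hn; rewrite /m Rpower_Rlog //; try lra.
by apply: Rdiv_lt_0_compat => //; exact: ln_d_gt0.
Qed.

Lemma m_unbounded B : exists N, forall n, (N <= n)%N -> B < m n.
Proof.
have lr := ln_r_gt0; have ld := ln_d_gt0.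
have [N hN] := ln_INR_unbounded (ln (/ zeta) * exp (B * ln r)).
exists N => n /hN h.
have p : 0 < ln (/ zeta) * exp (B * ln r) by apply: Rmult_lt_0_compat => //; exact: exp_pos.
rewrite /m /Rlog; apply/Rcomplements.Rlt_div_r => //.
rewrite -(ln_exp (B * ln r)); apply: ln_increasing; first exact: exp_pos.
by apply/Rcomplements.Rlt_div_r => //; lra.
Qed.

(** By definition of [m], [n = (/ zeta) ^ (r ^ m n)]. *)
Lemma INR_mul_Rpower_zeta n x : (0 < n)%N -> 0 < ln (INR n) ->
  INR n * Rpower zeta x = exp (ln (/ zeta) * (Rpower r (m n) - x)).
Proof.
move=> hn0 hn; have ld := ln_d_gt0.
have n0 : 0 < INR n by apply: lt_0_INR; apply/ltP.
rewrite Rpower_r_m // /Rpower -{1}(exp_ln (INR n)) // -exp_plus.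
by congr exp; rewrite ln_Rinv; [field; rewrite ln_Rinv in ld|]; lra.
Qed.

(** For [h >= m n + eta], [r ^ h] exceeds [r ^ m n] by the factor [r ^ eta > 1], so the
    product is at most [n ^ (1 - r ^ eta)]. *)
Lemma scale_high eta e : 0 < eta -> 0 < e -> exists N, forall n, (N <= n)%N ->
  forall h, m n + eta <= INR h -> INR n * Rpower zeta (r ^ h) <= e.
Proof.
move=> heta he; have lr := ln_r_gt0; have ld := ln_d_gt0.
set g := Rpower r eta - 1.
have g0 : 0 < g.
  have : 1 < Rpower r eta; last by rewrite /g; lra.
  by rewrite -(Rpower_O r); [apply: Rpower_lt|]; lra.
have [N1 hN1] := ln_INR_unbounded 0.
have [N2 hN2] := ln_INR_unbounded (- ln e / g).
exists (maxn N1 N2).+1 => n hn; have n0 : (0 < n)%N by exact: leq_trans hn.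
move: (ltnW hn); rewrite geq_max => /andP [/hN1 h1 /hN2 h2] h hh.
rewrite INR_mul_Rpower_zeta // -(exp_ln e) //; apply: exp_le_exp.
have hr : Rpower r (m n) * Rpower r eta <= r ^ h.
  rewrite -Rpower_plus -Rpower_pow; last lra.
  by apply: Rle_Rpower; lra.
have := Rmult_le_compat_l _ _ _ (Rlt_le _ _ ld) hr.
have := Rpower_r_m n h1 => E.
have E2 : ln (/ zeta) * Rpower r (m n) = ln (INR n) by rewrite E; field; lra.
have : - ln e < ln (INR n) * g by apply/Rcomplements.Rlt_div_l.
rewrite -Rmult_assoc E2 /g => k1 k2.
rewrite Rmult_minus_distr_l E2; lra.
Qed.

(** For [h <= m n - eta] the product is at least [n ^ (1 - r ^ (- eta))]. *)
Lemma scale_low eta B : 0 < eta -> exists N, forall n, (N <= n)%N ->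
  forall h, INR h <= m n - eta -> B <= INR n * Rpower zeta (r ^ h).
Proof.
move=> heta; have lr := ln_r_gt0; have ld := ln_d_gt0.
set g := 1 - Rpower r (- eta).
have g0 : 0 < g.
  have : Rpower r (- eta) < 1; last by rewrite /g; lra.
  by rewrite -(Rpower_O r); [apply: Rpower_lt|]; lra.
have [N1 hN1] := ln_INR_unbounded 0.
have [N2 hN2] := ln_INR_unbounded (B / g).
exists (maxn N1 N2).+1 => n hn; have n0 : (0 < n)%N by exact: leq_trans hn.
move: (ltnW hn); rewrite geq_max => /andP [/hN1 h1 /hN2 h2] h hh.
rewrite INR_mul_Rpower_zeta //.
have hr : r ^ h <= Rpower r (m n) * Rpower r (- eta).
  rewrite -Rpower_plus -Rpower_pow; last lra.
  by apply: Rle_Rpower; lra.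
have := Rmult_le_compat_l _ _ _ (Rlt_le _ _ ld) hr.
have := Rpower_r_m n h1 => E.
have E2 : ln (/ zeta) * Rpower r (m n) = ln (INR n) by rewrite E; field; lra.
have : B < ln (INR n) * g by apply/Rcomplements.Rlt_div_l.
rewrite -Rmult_assoc E2 /g => k1 k2.
apply: Rle_trans (exp_ineq1_le _).
rewrite Rmult_minus_distr_l E2; lra.
Qed.

(** In what follows [p h n] stands for the probability that [X n <= h], and [s h] for
    the relative excess of [rhoh h] over [rho]. *)
Variables (p : nat -> nat -> R) (s : nat -> R) (ok : nat -> Prop) (c1 c2 : R) (H0 : nat).
Hypotheses (c1_gt0 : 0 < c1)
  (s_bnd : forall h, (H0 <= h)%N ->
     c1 * Rpower zeta (r ^ h) <= s h <= c2 * Rpower zeta (r ^ h))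
  (p_bnd : forall n, ok n -> forall h, 0 <= p h n <= 1)
  (p_mono : forall n, ok n -> forall h, p h n <= p h.+1 n)
  (p_asympt : forall eps, 0 < eps -> exists N H, forall n, (N <= n)%N -> ok n /\
     forall h, (H <= h)%N -> Rabs (p h n * (1 + s h) ^ n - 1) <= eps).

Lemma s_gt0 h : (H0 <= h)%N -> 0 < s h.
Proof.
move=> /s_bnd [h1 _]; apply: Rlt_le_trans h1.
by apply: Rmult_lt_0_compat => //; exact: exp_pos.
Qed.

(** [p h n] is about [(1 + s h) ^ (- n) >= exp (- n s h)], and [n s h] is small. *)
Lemma cdf_high eta eps : 0 < eta -> 0 < eps -> exists N, forall n, (N <= n)%N ->
  forall h, m n + eta <= INR h -> 1 - eps <= p h n.
Proof.
move=> heta heps.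
have he2 : 0 < eps / 2 by lra.
have [N1 [H1 A]] := p_asympt _ he2.
have c2' : 0 < Rabs c2 + 1 by have := Rabs_pos c2; lra.
have [N2 B] := scale_high eta (eps / 2 / (Rabs c2 + 1)) heta ltac:(exact: Rdiv_lt_0_compat).
have [N3 D] := m_unbounded (INR (maxn H0 H1)).
exists (maxn N1 (maxn N2 N3)) => n; rewrite !geq_max => /andP [n1 /andP [n2 n3]] h hh.
have hH : (maxn H0 H1 <= h)%N.
  by apply/leP; apply: INR_le; have := D n n3; lra.
move: hH; rewrite geq_max => /andP [k0 k1].
have [okn {}A] := A n n1; have {}A := A h k1; have {}B := B n n2 h hh.
have s0 := s_gt0 h k0; have [_ s2] := s_bnd h k0.
have [p0 p1] := p_bnd n okn h.
set w := Rpower zeta (r ^ h) in B s2.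
have w0 : 0 < w by exact: exp_pos.
have ns : INR n * s h <= eps / 2.
  have n0 := pos_INR n.
  have : s h <= (Rabs c2 + 1) * w by have := Rle_abs c2; nra.
  move=> /(Rmult_le_compat_l _ _ _ n0).
  have := Rmult_le_compat_l _ _ _ (Rlt_le _ _ c2') B.
  have -> : (Rabs c2 + 1) * (eps / 2 / (Rabs c2 + 1)) = eps / 2 by field; lra.
  lra.
have E : (1 + s h) ^ n <= exp (INR n * s h).
  rewrite -Rpower_pow; last lra.
  rewrite /Rpower; apply: exp_le_exp; apply: Rmult_le_compat_l; first exact: pos_INR.
  by have := ln_le_sub1 (1 + s h); lra.
move/Rabs_le_between: A => A.
have F : 1 - eps / 2 <= p h n * exp (INR n * s h).
  apply: Rle_trans (_ : p h n * (1 + s h) ^ n <= _); first lra.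
  exact: Rmult_le_compat_l.
have G := exp_ineq1_le (- (INR n * s h)).
have e0 := exp_pos (- (INR n * s h)).
have K : exp (INR n * s h) * exp (- (INR n * s h)) = 1.
  by rewrite -exp_plus Rplus_opp_r exp_0.
have := Rmult_le_compat_r _ _ _ (Rlt_le _ _ e0) F.
rewrite Rmult_assoc K Rmult_1_r => {}F.
case: (Rle_lt_dec 1 eps) => h1; first lra.
have ns0 : 0 <= INR n * s h by apply: Rmult_le_pos; [exact: pos_INR|lra].
nra.
Qed.

(** [p h n] is about [(1 + s h) ^ (- n) <= 1 / (1 + n s h)], and [n s h] is large. The
    asymptotics only apply to large [h]; monotonicity covers the others. *)
Lemma cdf_low eta eps : 0 < eta -> 0 < eps -> exists N, forall n, (N <= n)%N ->
  forall h, INR h <= m n - eta -> p h n <= eps.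
Proof.
move=> heta heps.
have [N1 [H1 A]] := p_asympt 1 Rlt_0_1.
have [N2 B] := scale_low eta (2 / (c1 * eps)) heta.
have [N3 D] := m_unbounded (INR (maxn H0 H1) + eta).
exists (maxn N1 (maxn N2 N3)) => n; rewrite !geq_max => /andP [n1 /andP [n2 n3]] h hh.
have [okn {}A] := A n n1.
set h' := maxn h (maxn H0 H1).
have hh' : INR h' <= m n - eta.
  by rewrite /h' /maxn; case: ifP => _ //; have := D n n3; rewrite /maxn; lra.
apply: Rle_trans (_ : p h' n <= _).
  have hle : (h <= h')%N by exact: leq_maxl.
  rewrite -(subnK hle); elim: (h' - h)%N => [|j IH]; first by rewrite add0n; lra.
  by apply: Rle_trans IH _; rewrite addSn; exact: p_mono.
have k0 : (H0 <= h')%N by rewrite /h' !leq_max leqnn orbT.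
have k1 : (H1 <= h')%N by rewrite /h' !leq_max leqnn !orbT.
have {}A := A h' k1; have {}B := B n n2 h' hh'.
have s0 := s_gt0 h' k0; have [s1 _] := s_bnd h' k0.
have [p0 _] := p_bnd n okn h'.
move/Rabs_le_between: A => A.
have E := poly n _ s0.
have n0 := pos_INR n.
have F : p h' n * (1 + INR n * s h') <= 2.
  apply: Rle_trans (_ : p h' n * (1 + s h') ^ n <= _); last lra.
  exact: Rmult_le_compat_l.
have G : 2 / eps <= INR n * s h'.
  have := Rmult_le_compat_l _ _ _ n0 s1.
  have := Rmult_le_compat_l _ _ _ (Rlt_le _ _ c1_gt0) B.
  have -> : c1 * (2 / (c1 * eps)) = 2 / eps by field; lra.
  lra.
have q : 0 < 2 / eps by apply: Rdiv_lt_0_compat; lra.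
have K : p h' n * (2 / eps) <= 2 by nra.
have := Rmult_le_compat_r _ _ _ (Rlt_le _ _ heps) K.
have -> : p h' n * (2 / eps) * eps = 2 * p h' n by field; lra.
lra.
Qed.

End Scale.

Lemma round_half_down_near x : x - 1 / 2 <= IZR (round_half_down x) <= x + 1 / 2.
Proof.
have [f1 f2] := Zfloor_bound x; have [g1 g2] := Zceil_bound x.
have e : frac_part x = x - IZR (Zfloor x) by [].
rewrite /round_half_down; case: Rle_dec => /= h; rewrite e in h; first lra.
split; first lra.
have : (Zceil x < Zfloor x + 2)%Z by apply: lt_IZR; rewrite plus_IZR; lra.
move=> k; have {}k : (Zceil x <= Zfloor x + 1)%Z by lia.
by move/IZR_le: k; rewrite plus_IZR; lra.
Qed.

Lemma Zceil_of_frac_part x eps : 0 < eps -> eps <= frac_part x <= 1 - eps ->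
  x + eps <= IZR (Zceil x) <= x - eps + 1.
Proof.
move=> he; have -> : frac_part x = x - IZR (Zfloor x) by [].
have [f1 f2] := Zfloor_bound x; have [g1 g2] := Zceil_bound x => h.
have k1 : (Zceil x < Zfloor x + 2)%Z by apply: lt_IZR; rewrite plus_IZR; lra.
have k2 : (Zfloor x < Zceil x)%Z by apply: lt_IZR; lra.
have -> : Zceil x = (Zfloor x + 1)%Z by lia.
rewrite plus_IZR; lra.
Qed.

(** * Concentration *)

Lemma Pr_between (disp : measure_display) (T : measurableType disp)
    (P : probability T R) (X : {RV P >-> nat}) j l : (j <= l)%N ->
  Pr P [set t | (j < X t <= l)%N]%classic =
  Pr P [set t | (X t <= l)%N]%classic - Pr P [set t | (X t <= j)%N]%classic.
Proof.
move=> jl.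
have meas (Q : set nat) : measurable (X @^-1` Q)%classic by exact: measurable_funPTI.
have mA := meas [set k | (k <= j)%N]%classic.
have mB := meas [set k | (j < k <= l)%N]%classic.
have mU : P (X @^-1` [set k | (k <= j)%N] `|` X @^-1` [set k | (j < k <= l)%N])%classic =
  (P (X @^-1` [set k | (k <= j)%N])%classic + P (X @^-1` [set k | (j < k <= l)%N])%classic)%E.
  apply: measureU => //; apply/seteqP; split => // t [] /= h1 /andP [h2 _].
  by move: h2; rewrite ltnNge h1.
have eU : (X @^-1` [set k | (k <= j)%N] `|` X @^-1` [set k | (j < k <= l)%N])%classic =
   [set t | (X t <= l)%N]%classic.
  apply/seteqP; split => t /=.
    by case=> [h|/andP []//]; exact: leq_trans h jl.
  by move=> h; case: (leqP (X t) j) => h'; [left|right; apply/andP].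
rewrite eU in mU.
have fA : fine (P [set t | (X t <= l)%N]%classic) =
  Rplus (fine (P [set t | (X t <= j)%N]%classic)) (fine (P [set t | (j < X t <= l)%N]%classic)).
  by rewrite mU fineD //; apply: fin_num_measure.
by rewrite /Pr fA; symmetry; exact: Rplus_minus_l.
Qed.

Lemma Rpower_double_exp_lim zeta r : 0 < zeta < 1 -> 1 < r ->
  is_lim_seq (fun h => Rpower zeta (r ^ h)) 0.
Proof.
move=> hz hr.
have lz : ln zeta < 0 by rewrite -ln_1; apply: ln_increasing; lra.
apply: (is_lim_seq_le_le (fun _ => 0) _ (fun h => (Rpower zeta (r - 1)) ^ h)).
- move=> h; split; first exact/Rlt_le/exp_pos.
  rewrite -(Rpower_pow h (Rpower zeta (r - 1))); last exact: exp_pos.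
  rewrite Rpower_mult /Rpower; apply: exp_le_exp.
  have := poly h (r - 1) ltac:(lra).
  rewrite (_ : 1 + (r - 1) = r); last by ring.
  move=> k; have : INR h * (r - 1) <= r ^ h by lra.
  nra.
- exact: is_lim_seq_const.
apply: is_lim_seq_geom; rewrite Rabs_pos_eq; last exact/Rlt_le/exp_pos.
rewrite -[X in _ < X]exp_0 /Rpower; apply: exp_increasing; nra.
Qed.

Theorem theorem1p4
  (y : nat -> nat -> R) (yl : nat -> R)
  (y_ge0 : forall h n, 0 <= y h n)
  (y_mono : forall h n, y h n <= y (S h) n)
  (y_lim : forall n, is_lim_seq (fun h => y h n) (yl n))
  (disp : nat -> measure_display)
  (T : forall n, measurableType (disp n))
  (P : forall n, probability (T n) R)
  (X : forall n, {RV (P n) >-> nat})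
  (X_law : forall n, yl n <> 0 -> forall h,
     Pr (P n) [set t | (X n t <= h)%N]%classic = y h n / yl n)
  (rhoh : nat -> R) (rho kappa zeta r : R)
  (rho_gt0 : 0 < rho) (kappa_gt0 : 0 < kappa)
  (zeta_bnd : 0 < zeta < 1) (r_gt1 : 1 < r)
  (rhoh_neq0 : forall h, rhoh h <> 0)
  (rhoh_asympt : exists e : nat -> R, is_lim_seq e 0 /\
     forall h, rhoh h =
       rho * (1 + kappa * Rpower zeta (r ^ h) + e h * Rpower zeta (r ^ h)))
  (delta phi alpha : R)
  (delta_gt0 : 0 < delta) (phi_bnd : 0 < phi < PI / 2)
  (alpha_notin : forall k : nat, alpha <> INR k)
  (Yh Uh : nat -> C -> C) (Ah : nat -> C) (A : C)
  (Yh_cont : forall h, continues (y h) (Yh h) /\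
     analytic_on (slit_disc delta phi (rhoh h)) (Yh h))
  (Yh_sing : forall h,
     singular_at (slit_disc delta phi (rhoh h)) (Yh h) (RtoC (rhoh h)))
  (Uh_analytic : forall h, analytic_on (closed_disc delta (rhoh h)) (Uh h))
  (Uh_bounded : exists M, forall h x, closed_disc delta (rhoh h) x ->
     Cmod (Uh h x) <= M)
  (Ah_lim : filterlim Ah eventually (locally A)) (A_neq0 : A <> RtoC 0)
  (Yh_exp : exists omega, error_modulus omega /\
     forall h, expansion (slit_disc delta phi (rhoh h))
       (Yh h) (Uh h) (Ah h) alpha (rhoh h) omega)
  (Y U : C -> C)
  (Y_cont : continues yl Y /\ analytic_on (slit_disc delta phi rho) Y)
  (U_analytic : analytic_on (slit_disc delta phi rho) U)
  (Y_exp : exists omega, error_modulus omega /\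
     expansion (slit_disc delta phi rho) Y U A alpha rho omega) :
  let m n := Rlog r (Rlog (/ zeta) (INR n)) in
  (exists hn : nat -> nat,
     eventually (fun n => Z.of_nat (hn n) = round_half_down (m n)) /\
     is_lim_seq
       (fun n => Pr (P n) [set t | X n t = hn n \/ X n t = S (hn n)]%classic)
       1) /\
  (forall eps, 0 < eps ->
     filterlim
       (fun n => Pr (P n) [set t | Z.of_nat (X n t) = Zceil (m n)]%classic)
       (within (fun n => eps <= frac_part (m n) <= 1 - eps) eventually)
       (locally 1)).
Proof.
move=> m.
case: rhoh_asympt => e [e_lim rhohE].
case: Uh_bounded => M hM.
case: Yh_exp => omega [omegaP hexp].
set w := fun h => Rpower zeta (r ^ h).
have w_lim : is_lim_seq w 0 by exact: Rpower_double_exp_lim.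
have w0 h : 0 < w h by exact: exp_pos.
pose s h := (kappa + e h) * w h.
have rhohE' h : rhoh h = rho * (1 + s h) by rewrite rhohE /s /w; ring.
have [H0 s_bnd] : exists H0, forall h, (H0 <= h)%N ->
    kappa / 2 * w h <= s h <= 2 * kappa * w h.
  have k2 : 0 < kappa / 2 by lra.
  have /is_lim_seq_spec /(_ (mkposreal _ k2)) [H0 hH0] := e_lim.
  exists H0 => h /leP /hH0 /=; rewrite Rminus_0_r => /Rabs_lt_between he.
  by have := w0 h; rewrite /s; split; apply: Rmult_le_compat_r; lra.
have s0 h : (H0 <= h)%N -> 0 < s h.
  by move=> /s_bnd [h1 _]; have := Rmult_lt_0_compat (kappa / 2) _ ltac:(lra) (w0 h); lra.
have rhoh_gt0 h : (H0 <= h)%N -> 0 < rhoh h.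
  by move=> /s0 h1; rewrite rhohE'; apply: Rmult_lt_0_compat; lra.
have rhoh_lim : is_lim_seq rhoh rho.
  apply: (is_lim_seq_ext (fun h => rho * (1 + s h))) => [h|]; first by rewrite rhohE'.
  have h1 : is_lim_seq s ((kappa + 0) * 0).
    apply: is_lim_seq_mult' w_lim; apply: is_lim_seq_plus' e_lim.
    exact: is_lim_seq_const.
  rewrite Rmult_0_r in h1.
  have -> : Finite rho = Finite (rho * (1 + 0)) by congr Finite; ring.
  apply: is_lim_seq_mult'; first exact: is_lim_seq_const.
  by apply: is_lim_seq_plus' h1; exact: is_lim_seq_const.
have unif : forall eps, 0 < eps -> exists N H, forall h n, (H <= h)%N -> (N <= n)%N ->
    Cmod (RtoC (y h n * rhoh h ^ n / bin_coef alpha n) - Ah h) <= eps.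
  move=> eps eps0.
  have [c [N1 [c0 hN1]]] := bin_coef_lower alpha alpha_notin.
  have [N2 hN2] := transfer delta phi alpha M omega delta_gt0 phi_bnd omegaP
    (eps * c) ltac:(exact: Rmult_lt_0_compat).
  exists (maxn N1 N2), H0 => h n hh; rewrite geq_max => /andP [/hN1 n1 n2].
  have [hc ha] := Yh_cont h.
  have t := hN2 (y h) (Yh h) (Uh h) (Ah h) (rhoh h) (rhoh_gt0 h hh) hc ha
    (Uh_analytic h) (hM h) (hexp h) n n2.
  have b0 := bin_coef_neq0 alpha n alpha_notin.
  have b0' : RtoC (bin_coef alpha n) <> 0 by move=> [].
  have -> : (RtoC (y h n * rhoh h ^ n / bin_coef alpha n) - Ah h =
    (RtoC (y h n * rhoh h ^ n) - Ah h * RtoC (bin_coef alpha n)) /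
    RtoC (bin_coef alpha n))%C by rewrite RtoC_div //; field.
  rewrite Cmod_div // Cmod_R; apply/Rcomplements.Rle_div_l; first exact: Rabs_pos_lt.
  have := Rmult_le_compat_l _ _ _ (Rlt_le _ _ eps0) n1; lra.
pose p h n := y h n / yl n.
have p_asympt : forall eps, 0 < eps -> exists N H, forall n, (N <= n)%N -> yl n <> 0 /\
    forall h, (H <= h)%N -> Rabs (p h n * (1 + s h) ^ n - 1) <= eps.
  move=> eps eps0.
  have [N [H hN]] := coef_ratio y yl (bin_coef alpha) rhoh rho Ah A y_lim
    (fun n => bin_coef_neq0 alpha n alpha_notin) rho_gt0 rhoh_lim Ah_lim A_neq0 unif eps eps0.
  exists N, H => n /hN [h1 h2]; split=> // h /h2.
  by have -> : rhoh h / rho = 1 + s h by rewrite rhohE'; field; lra.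
have y_le h n : y h n <= yl n.
  exact: (is_lim_seq_incr_compare (fun h => y h n) (yl n) (y_lim n) (fun h => y_mono h n)).
have yl_gt0 n : yl n <> 0 -> 0 < yl n.
  by have := y_ge0 0%N n; have := y_le 0%N n; lra.
have p_bnd n : yl n <> 0 -> forall h, 0 <= p h n <= 1.
  move=> /yl_gt0 h0 h; split; first by apply: Rdiv_le_0_compat.
  by apply/Rcomplements.Rle_div_l => //; rewrite Rmult_1_l; exact: y_le.
have p_mono n : yl n <> 0 -> forall h, p h n <= p h.+1 n.
  move=> /yl_gt0 h0 h; apply: Rmult_le_compat_r; last exact: y_mono.
  exact/Rlt_le/Rinv_0_lt_compat.
have kappa2 : 0 < kappa / 2 by lra.
(* All the mass of [X n] is asymptotically within [eta] of [m n]. *)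
have window : forall eta eps, 0 < eta -> 0 < eps -> exists N, forall n, (N <= n)%N ->
    forall j l, INR j <= m n - eta -> m n + eta <= INR l ->
    Rabs (Pr (P n) [set t | (j < X n t <= l)%N]%classic - 1) < eps.
  move=> eta eps heta heps; have e3 : 0 < eps / 3 by lra.
  have [N1 B1] := cdf_high zeta r zeta_bnd r_gt1 p s (fun n => yl n <> 0) _ _ H0
    kappa2 s_bnd p_bnd p_asympt eta _ heta e3.
  have [N2 B2] := cdf_low zeta r zeta_bnd r_gt1 p s (fun n => yl n <> 0) _ _ H0
    kappa2 s_bnd p_bnd p_mono p_asympt eta _ heta e3.
  have [N3 [H3 B3]] := p_asympt 1 Rlt_0_1.
  exists (maxn N1 (maxn N2 N3)) => n; rewrite !geq_max => /andP [n1 /andP [n2 n3]] j l hj hl.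
  have [yn _] := B3 n n3.
  have jl : (j <= l)%N by apply/leP; apply: INR_le; lra.
  rewrite Pr_between // !X_law // -/(p l n) -/(p j n).
  have := B1 n n1 l hl; have := B2 n n2 j hj.
  have := p_bnd n yn j; have := p_bnd n yn l.
  by move=> h1 h2 h3 h4; apply/Rabs_lt_between; lra.
split.
  pose hn n := Z.to_nat (round_half_down (m n)).
  have [N hN] := m_unbounded zeta r zeta_bnd r_gt1 2.
  have hnE n : (N <= n)%N -> Z.of_nat (hn n) = round_half_down (m n) /\ (0 < hn n)%N.
    move=> /hN h1; have := round_half_down_near (m n) => h2.
    have h3 : (1 < round_half_down (m n))%Z by apply: lt_IZR; rewrite -/(m n) in h1; lra.
    by split; rewrite /hn; [apply: Z2Nat.id; lia|apply/ltP; lia].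
  exists hn; split; first by exists N => n /leP /hnE [].
  apply/is_lim_seq_spec => eps.
  have [N' hN'] := window (1 / 2) eps ltac:(lra) (cond_pos eps).
  exists (maxn N N') => n /leP; rewrite geq_max => /andP [/hnE [E h0] n2].
  have near := round_half_down_near (m n).
  rewrite -E -INR_IZR_INZ in near.
  have := hN' n n2 (hn n).-1 (hn n).+1.
  have e1 : INR (hn n) = INR (hn n).-1 + 1 by rewrite -S_INR prednK.
  rewrite S_INR => /(_ ltac:(lra) ltac:(lra)).
  congr (Rabs (Pr _ _ - 1) < _); apply/seteqP; split => t /=.
    by rewrite prednK // => /andP [/leP h1 /leP h2]; lia.
  by move=> h; apply/andP; split; apply/leP; rewrite ?prednK //; lia.
move=> eps heps; apply/filterlim_locally => e'.
have [N hN] := m_unbounded zeta r zeta_bnd r_gt1 2.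
have [N' hN'] := window eps e' heps (cond_pos e').
exists (maxn N N') => n /leP; rewrite geq_max => /andP [/hN n1 n2] hfr.
rewrite -/(m n) in n1.
have near := Zceil_of_frac_part _ _ heps hfr.
have z1 : (1 < Zceil (m n))%Z by apply: lt_IZR; lra.
set k := Z.to_nat (Zceil (m n)).
have E : Z.of_nat k = Zceil (m n) by apply: Z2Nat.id; lia.
have k0 : (0 < k)%N by apply/ltP; lia.
rewrite -E -INR_IZR_INZ in near.
have e1 : INR k = INR k.-1 + 1 by rewrite -S_INR prednK.
have := hN' n n2 k.-1 k ltac:(lra) ltac:(lra).
rewrite /ball /= /AbsRing_ball /abs /minus /plus /opp /=.
congr (Rabs (Pr _ _ - 1) < _); apply/seteqP; split => t /=.
  by rewrite prednK // -E => /andP [/leP h1 /leP h2]; lia.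
by rewrite -E => h; apply/andP; split; apply/leP; rewrite ?prednK //; lia.
Qed.
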